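(* Let $\mathtt{k}>0$, $a>0$, $x>0$, let $\eta,\rho,\nu,c\in\mathbb{C}$ and let $\alpha<1$ be real, such that $\Re(\eta)>0$, $\Re(\rho)>0$, $\nu>-\frac{3}{2}\mathtt{k}$ (in particular $\nu$ is real) and $\Re\left(\frac{\eta}{1-\alpha}\right)>-1$. Assume that $t\mapsto t^{\rho-1}\mathtt{S}_{\nu,c}^{\mathtt{k}}(t)$ is Lebesgue integrable on $\left(0,\frac{x}{a(1-\alpha)}\right)$. Then $$ P_{0+}^{(\eta,\alpha)}\left[t^{\rho-1}\mathtt{S}_{\nu,c}^{\mathtt{k}}(t)\right](x)=x^{\eta}\left(\frac{x}{a(1-\alpha)}\right)^{\rho+\frac{\nu}{\mathtt{k}}+1}\frac{\Gamma\left(1+\frac{\eta}{1-\alpha}\right)}{\mathtt{k}^{\frac{\nu}{\mathtt{k}}+\frac12}\,2^{\frac{\nu}{\mathtt{k}}+1}}\;{}_{2}\Psi_{3}\left[\begin{array}{c}\left(\rho+\frac{\nu}{\mathtt{k}}+1,2\right),\ (1,1)\\ \left(\rho+\frac{\nu}{\mathtt{k}}+\frac{\eta}{1-\alpha}+2,2\right),\ \left(\frac{\nu}{\mathtt{k}}+\frac32,1\right),\ \left(\frac32,1\right)\end{array}\bigg|\,-\frac{c\,x^{2}}{4\mathtt{k}\,a^{2}(1-\alpha)^{2}}\right]. $$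
   Context: The $\mathtt{k}$-gamma function satisfies $\Gamma_{\mathtt{k}}(z)=\mathtt{k}^{\frac{z}{\mathtt{k}}-1}\Gamma\left(\frac{z}{\mathtt{k}}\right)$ for $\mathtt{k}>0$, where $\Gamma$ is the Euler gamma function. The $\mathtt{k}$-Struve function is, for $t>0$, $$\mathtt{S}_{\nu,c}^{\mathtt{k}}(t)=\sum_{r=0}^{\infty}\frac{(-c)^r}{\Gamma_{\mathtt{k}}\left(r\mathtt{k}+\nu+\frac{3\mathtt{k}}{2}\right)\Gamma\left(r+\frac32\right)}\left(\frac{t}{2}\right)^{2r+\frac{\nu}{\mathtt{k}}+1}.$$ The pathway fractional integral operator, with $a>0$, $\eta\in\mathbb{C}$, $\Re(\eta)>0$ and pathway parameter $\alpha<1$, is defined for $x>0$ and integrable $f$ by $$\left(P_{0+}^{(\eta,\alpha)}f\right)(x)=x^{\eta}\int_{0}^{\frac{x}{a(1-\alpha)}}\left[1-\frac{a(1-\alpha)t}{x}\right]^{\frac{\eta}{1-\alpha}}f(t)\,dt.$$ $P_{0+}^{(\eta,\alpha)}[f(t)](x)$ denotes $\left(P_{0+}^{(\eta,\alpha)}f\right)(x)$. Complex powers of positive reals are taken with the real logarithm. The generalized Wright hypergeometric function is $${}_{p}\Psi_{q}\left[\begin{array}{c}(a_1,\alpha_1),\dots,(a_p,\alpha_p)\\(b_1,\beta_1),\dots,(b_q,\beta_q)\end{array}\bigg|\,z\right]=\sum_{n=0}^{\infty}\frac{\prod_{i=1}^{p}\Gamma(a_i+\alpha_i n)}{\prod_{j=1}^{q}\Gamma(b_j+\beta_j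 n)}\frac{z^{n}}{n!},$$ with $a_i,b_j\in\mathbb{C}$ and $\alpha_i,\beta_j\in\mathbb{R}$; it is an entire function of $z$ when $\sum_{j}\beta_j-\sum_{i}\alpha_i>-1$. *)

(* Defs.v *)
From mathcomp Require Import all_boot all_order all_algebra.
From mathcomp Require Import complex.
From mathcomp Require Import all_classical all_reals all_analysis.

Set Implicit Arguments.
Unset Strict Implicit.
Unset Printing Implicit Defensive.

Import Order.TTheory GRing.Theory Num.Theory.
Import numFieldNormedType.Exports.

Local Open Scope classical_set_scope.
Local Open Scope ring_scope.
Local Open Scope complex_scope.

(* The complex numbers are R[i]; its alias R[i]^o carries the norm topology. *)
Definition csum (R : realType) (u : nat -> R[i]) : R[i] :=
  lim (series (u : nat -> R[i]^o) @ \oo).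

Definition cintegrable (R : realType) (D : set R) (f : R -> R[i]) : Prop :=
  (@lebesgue_measure R).-integrable D (fun t : R => (complex.Re (f t))%:E) /\
  (@lebesgue_measure R).-integrable D (fun t : R => (complex.Im (f t))%:E).

Definition cintegral (R : realType) (D : set R) (f : R -> R[i]) : R[i] :=
  Rintegral (@lebesgue_measure R) D (fun t : R => complex.Re (f t)) +i*
  Rintegral (@lebesgue_measure R) D (fun t : R => complex.Im (f t)).

(* t ^ w = exp (w ln t) with the real logarithm; only meaningful for 0 < t. *)
Definition cpowR (R : realType) (t : R) (w : R[i]) : R[i] :=
  (expR (complex.Re w * ln t))%:C *
  (cos (complex.Im w * ln t) +i* sin (complex.Im w * ln t)).

(* Euler's integral of the second kind, for 0 < Re z. *)
Definition euler_integral (R : realType) (z : R[i]) : R[i] :=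
  cintegral `]0%R, +oo[ (fun t : R => cpowR t (z - 1) * (expR (- t))%:C).

(* Gamma(z) = Gamma(z + n) / (z (z + 1) ... (z + n - 1)), where n is the least
   natural number with 0 < Re (z + n); in particular n = 0 if 0 < Re z.  At a
   pole the denominator vanishes, so Gamma z = 0 and (Gamma z)^-1 = 0, the
   value there of the entire function 1 / Gamma. *)
Definition Gamma (R : realType) (z : R[i]) : R[i] :=
  let n := Num.truncn (1 - complex.Re z) in
  euler_integral (z + n%:R) / \prod_(j < n) (z + j%:R).

Definition kGamma (R : realType) (k : R) (z : R[i]) : R[i] :=
  cpowR k (z / k%:C - 1) * Gamma (z / k%:C).

Definition kStruve (R : realType) (k : R) (nu c : R[i]) (t : R) : R[i] :=
  csum (fun r =>
    (- c) ^+ r /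
      (kGamma k (r%:R * k%:C + nu + 3 * k%:C / 2) *
       Gamma (r%:R + 3 / 2)) *
    cpowR (t / 2) ((2 * r)%:R + nu / k%:C + 1)).

Definition pathway (R : realType) (a : R) (eta : R[i]) (alpha : R)
    (f : R -> R[i]) (x : R) : R[i] :=
  cpowR x eta *
  cintegral `]0, x / (a * (1 - alpha))[
    (fun t => cpowR (1 - a * (1 - alpha) * t / x)
                    (eta / (1 - alpha)%:C) * f t).

(* num lists the pairs (a_i, alpha_i) and den the pairs (b_j, beta_j). *)
Definition wrightPsi (R : realType) (num den : seq (R[i] * R)) (z : R[i]) :
    R[i] :=
  csum (fun n =>
    (\prod_(p <- num) Gamma (p.1 + p.2%:C * n%:R)) /
    (\prod_(q <- den) Gamma (q.1 + q.2%:C * n%:R)) *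
    (z ^+ n / (n`!)%:R)).

(* Main.v *)
(* Near 0 the integrand is comparable to t ^ (rho + nu / k), the leading Struve
   coefficient being nonzero, so integrability forces Re (rho + nu / k + 1) > 0.
   The coefficients are dominated by an exponential series, so dominated
   convergence allows termwise integration, and each term is a beta integral
   J_X(s, v) = int_0^X t^(s-1) (1 - t/X)^v dt.  An integration by parts gives
   (s + v + 1) J(s, v + 1) = (v + 1) J(s, v); iterating it, rescaling to X = n
   and letting (1 - t/n)^n tend to e^(-t) yields Gauss's product for Gamma and
   J_1(s, v) Gamma(s + v + 1) = Gamma(s) Gamma(v + 1).  Dividing requires that
   Gamma has no zero for Re z > 0: by the functional equation a zero could be
   moved to arbitrarily large Re z, where the integral is dominated by its mass
   near t = Re z. *)

Require Import Defs.
From mathcomp Require Import all_boot all_order all_algebra.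
From mathcomp Require Import complex.
From mathcomp Require Import all_classical all_reals all_analysis.
From mathcomp Require Import measurable_realfun ring lra.

Set Implicit Arguments.
Unset Strict Implicit.
Unset Printing Implicit Defensive.

Import Order.TTheory GRing.Theory Num.Theory.
Import numFieldNormedType.Exports.
Import Normc.

Local Open Scope classical_set_scope.
Local Open Scope ring_scope.
Local Open Scope complex_scope.

(** * Integrals over exhausted intervals *)

(** The beta-gamma relation is reached without double integrals: it is the limit of an identity
    between beta integrals over []0, n[] that holds exactly for every [n]. The integrands may be
    singular at the ends of an open interval, so integrals are evaluated on compact subintervals and
    passed to the limit. Two reductions keep the estimates elementary. The exponent v = eta / (1 -
    alpha) has positive real part, so (1 - t/X)^v has modulus at most 1 and the delicate endpoint is
    0. And nu is real, so nu = k lam with lam > -3/2: quotients of successive Struve denominators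
    are then positive reals, bounded below by a constant times r + 1, whence the factorial decay.
    The nonvanishing of Gamma serves the beta formula and also the lower bound near 0: as division
    by zero yields 0, the leading coefficient is nonzero because its denominator is. *)

Section real_integrals.
Context {R : realType}.
Notation mu := (@lebesgue_measure R).

Lemma integrable_EFinD (D : set R) (f g : R -> R) : measurable D ->
  mu.-integrable D (EFin \o f) -> mu.-integrable D (EFin \o g) ->
  mu.-integrable D (EFin \o (fun t => f t + g t)).
Proof. by move=> mD fi gi; exact: (@integrableD _ _ _ mu D mD _ _ fi gi). Qed.

Lemma integrable_EFinZ (D : set R) (c : R) (f : R -> R) : measurable D ->
  mu.-integrable D (EFin \o f) -> mu.-integrable D (EFin \o (fun t => c * f t)).
Proof. by move=> mD fi; exact: (@integrableZl _ _ _ mu D mD c _ fi). Qed.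

Lemma integrable_EFinB (D : set R) (f g : R -> R) : measurable D ->
  mu.-integrable D (EFin \o f) -> mu.-integrable D (EFin \o g) ->
  mu.-integrable D (EFin \o (fun t => f t - g t)).
Proof.
move=> mD fi gi.
have -> : (fun t => f t - g t) = (fun t => f t + (-1) * g t).
  by apply/funext => t; rewrite mulN1r.
by apply: integrable_EFinD => //; exact: integrable_EFinZ.
Qed.

Lemma dominated_cvg_Rintegral (D : set R) (f_ : nat -> R -> R) (f g : R -> R) :
  measurable D ->
  (forall n, measurable_fun D (f_ n)) ->
  (forall x, D x -> f_ ^~ x @ \oo --> f x) ->
  mu.-integrable D (EFin \o g) ->
  (forall n x, D x -> `|f_ n x| <= g x) ->
  mu.-integrable D (EFin \o f) /\
  Rintegral mu D (f_ n) @[n --> \oo] --> Rintegral mu D f.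
Proof.
move=> mD mf_ f_f ig f_g.
have mf : measurable_fun D f by exact: measurable_fun_cvg f_f.
have [] := @dominated_convergence _ _ _ mu D mD (fun n => EFin \o f_ n)
  (EFin \o f) (EFin \o g).
- by move=> n; apply/measurable_EFinP; exact: mf_.
- by apply/measurable_EFinP; exact: mf.
- by apply/aeW => x Dx; apply: cvg_EFin; [exact: nearW | exact: f_f].
- exact: ig.
- by apply/aeW => x n Dx /=; rewrite lee_fin f_g.
move=> fi _ cf; split => //.
apply: fine_cvg; rewrite fineK; first exact: cf.
exact: integrable_fin_num fi.
Qed.

(** Dominated convergence for the restrictions of [f] to [K n], with the absolute value of [f] as
    majorant. *)
Lemma cvg_Rintegral_exhaustion (D : set R) (K : nat -> set R) (f : R -> R) :
  measurable D -> (forall n, measurable (K n)) ->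
  (forall n, K n `<=` D) -> (forall x, D x -> \forall n \near \oo, K n x) ->
  mu.-integrable D (EFin \o f) ->
  Rintegral mu (K n) f @[n --> \oo] --> Rintegral mu D f.
Proof.
move=> mD mK KD DK fi.
rewrite (_ : (fun n => _) = (fun n => Rintegral mu D (f \_ (K n)))); last first.
  apply/funext => n; rewrite -Rintegral_mkcondr; congr Rintegral.
  by rewrite setIidr.
have mf : measurable_fun D f by apply/measurable_EFinP; exact: measurable_int fi.
apply: (dominated_cvg_Rintegral (g := fun x => `|f x|) mD _ _ _ _).2.
- move=> n; apply/(measurable_restrict f (mK n) mD).
  by apply: measurable_funS mf => // x [].
- move=> x Dx; apply: cvg_near_cst.
  by apply: filterS (DK x Dx) => n Knx; rewrite patchE mem_set.
- exact: integrable_norm fi.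
- by move=> n x Dx; rewrite patchE; case: ifP => _ //; rewrite normr0.
Qed.

Lemma FTC_itvcc (f F : R -> R) (a b : R) : a < b ->
  (forall x, a <= x <= b -> is_derive x 1 F (f x)) ->
  (forall x, a <= x <= b -> {for x, continuous f}) ->
  (\int[mu]_(x in `[a, b]) (f x)%:E = (F b - F a)%:E)%E.
Proof.
move=> ab dF cf.
have cF x : a <= x <= b -> {for x, continuous F}.
  by move=> /dF [d _]; apply: differentiable_continuous; exact/derivable1_diffP.
rewrite (continuous_FTC2 ab (F := F)).
- by rewrite -EFinB.
- apply: continuous_in_subspaceT => x /set_mem /=; rewrite in_itv/=.
  exact: cf.
- split.
  + move=> x; rewrite in_itv/= => /andP[/ltW ax /ltW xb].
    have [|d _] := dF x; first by rewrite ax.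
    exact: d.
  + by apply: cvg_at_right_filter; apply: cF; rewrite lexx ltW.
  + by apply: cvg_at_left_filter; apply: cF; rewrite lexx ltW.
- move=> x; rewrite in_itv/= => /andP[/ltW ax /ltW xb].
  have [|_ d] := dF x; first by rewrite ax.
  by rewrite derive1E.
Qed.

(** The fundamental theorem of calculus is applied on the compact intervals; an integral over [D],
    at whose ends the integrand may be singular, is the limit along them. *)
Definition exhausts (D : set R) (a b : nat -> R) :=
  [/\ forall m n, (m <= n)%N -> a n <= a m,
      forall m n, (m <= n)%N -> b m <= b n,
      forall n, a n < b n &
      D = \bigcup_n `[a n, b n]%classic].

Section exhausted.
Variables (D : set R) (a b : nat -> R).
Hypothesis Dab : exhausts D a b.

Lemma exhausts_sub n : `[a n, b n]%classic `<=` D.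
Proof. by case: Dab => _ _ _ -> x xn; exists n. Qed.

Lemma exhausts_near x : D x -> \forall n \near \oo, `[a n, b n]%classic x.
Proof.
case: Dab => da ib _ -> [m _] /=; rewrite in_itv/= => /andP[ax xb].
exists m => // n /= mn; rewrite in_itv/= (le_trans (da _ _ mn))//=.
by rewrite (le_trans xb)// ib.
Qed.

Lemma exhausts_measurable : measurable D.
Proof. by case: Dab => _ _ _ ->; apply: bigcup_measurable. Qed.

Variables (f F : R -> R).
Hypothesis cf : forall x, D x -> {for x, continuous f}.
Hypothesis dF : forall x, D x -> is_derive x 1 F (f x).

Let FTC n : (\int[mu]_(x in `[a n, b n]) (f x)%:E = (F (b n) - F (a n))%:E)%E.
Proof.
have [_ _ ab _] := Dab.
by apply: FTC_itvcc => // x xab; [apply: dF|apply: cf];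
  apply: (@exhausts_sub n); rewrite /= in_itv.
Qed.

Lemma exhausts_measurable_fun : measurable_fun D f.
Proof.
have [_ _ _ DE] := Dab.
rewrite DE; apply/measurable_fun_bigcup; first by move=> i; exact: measurable_itv.
move=> n; apply: subspace_continuous_measurable_fun; first exact: measurable_itv.
apply: continuous_in_subspaceT => x /set_mem xab.
by apply: cf; exact: exhausts_sub xab.
Qed.

(** Monotone convergence: the integrals over the compact intervals are increments of [F], increasing
    and bounded by [C], so their limit is finite. *)
Lemma integrable_bounded_primitive (C : R) :
  (forall x, D x -> 0 <= f x) -> (forall n, F (b n) - F (a n) <= C) ->
  mu.-integrable D (EFin \o f).
Proof.
move=> f0 FC; have mf := exhausts_measurable_fun.
have [da ib ab DE] := Dab.
apply/integrableP; split; first by apply/measurable_EFinP; exact: mf.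
rewrite [X in (X < _)%E](_ : _ = (\int[mu]_(x in D) (f x)%:E)%E); last first.
  apply: eq_integral.
  by move=> x /set_mem Dx /=; rewrite ger0_norm// f0.
apply: (@le_lt_trans _ _ C%:E); last exact: ltry.
have : (\int[mu]_(x in `[a n, b n]) (f x)%:E)%E @[n --> \oo] -->
    (\int[mu]_(x in D) (f x)%:E)%E.
  rewrite [in X in _ --> X]DE.
  apply: ge0_nondecreasing_set_cvg_integral.
  - move=> m n mn; apply/subsetPset => x /=; rewrite !in_itv/= => /andP[ax xb].
    by rewrite (le_trans (da _ _ mn))//= (le_trans xb)// ib.
  - by move=> n; exact: measurable_itv.
  - move=> n; apply/measurable_EFinP; apply: measurable_funS mf.
      exact: exhausts_measurable.
    exact: exhausts_sub.
  - by move=> n x xn; rewrite lee_fin f0//; exact: exhausts_sub xn.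
move/cvg_lim => <- //; apply: lime_le; last first.
  by apply: nearW => n; rewrite FTC lee_fin.
apply: ereal_nondecreasing_is_cvgn.
apply: ge0_nondecreasing_set_nondecreasing_integral.
- move=> m n mn; apply/subsetPset => x /=; rewrite !in_itv/= => /andP[ax xb].
  by rewrite (le_trans (da _ _ mn))//= (le_trans xb)// ib.
- by move=> n; exact: measurable_itv.
- move=> n; apply/measurable_EFinP; apply: measurable_funS mf.
    exact: exhausts_measurable.
  exact: exhausts_sub.
- by move=> n x xn; rewrite lee_fin f0//; exact: exhausts_sub xn.
Qed.

(** Here [f] may change sign; integrability is what identifies its integral with the limit of the
    increments of [F]. *)
Lemma Rintegral_primitive (A B : R) : mu.-integrable D (EFin \o f) ->
  F (a n) @[n --> \oo] --> A -> F (b n) @[n --> \oo] --> B ->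
  Rintegral mu D f = B - A.
Proof.
move=> fi FA FB.
have := cvg_Rintegral_exhaustion (K := fun n => `[a n, b n]%classic)
  exhausts_measurable (fun n => measurable_itv _) exhausts_sub exhausts_near fi.
move/cvg_lim => <- //; apply: cvg_lim => //.
rewrite (_ : (fun n => _) = (fun n => F (b n) - F (a n))).
  exact: cvgB.
by apply/funext => n; rewrite /Rintegral FTC.
Qed.

End exhausted.

(** The shift by 3 keeps X / (n + 3) below X / 2, so that the left end stays strictly below the
    right end from [n = 0] on. *)
Lemma exhausts_itvoo (X : R) : 0 < X ->
  exhausts `]0, X[%classic (fun n => X / n.+3%:R) (fun n => X - X / n.+3%:R).
Proof.
move=> X0; split.
- by move=> m n mn; rewrite ler_pM2l// lef_pV2 ?posrE ?ltr0n// ler_nat.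
- by move=> m n mn; rewrite lerB// ler_pM2l// lef_pV2 ?posrE ?ltr0n// ler_nat.
- move=> n; rewrite ltrBrDl -mulrDl ltr_pdivrMr ?ltr0n//.
  have : 2 < n.+3%:R :> R by rewrite ltr_nat.
  by nra.
- apply/seteqP; split => x /=.
  + rewrite in_itv/= => /andP[x0 xX].
    have [n nx] : exists n : nat, X / Num.min x (X - x) < n%:R.
      by exists (Num.truncn (X / Num.min x (X - x))).+1; rewrite truncnS_gt.
    have m0 : 0 < Num.min x (X - x) by rewrite lt_min x0 subr_gt0.
    have : X / n.+3%:R <= Num.min x (X - x).
      rewrite ler_pdivrMr ?ltr0n// mulrC -ler_pdivrMr//.
      by rewrite (le_trans (ltW nx))// ler_nat -addn3 leq_addr.
    rewrite le_min => /andP[h1 h2]; exists n => //=; rewrite in_itv/= h1/=.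
    by rewrite lerBrDl addrC -lerBrDl.
  + move=> [n _] /=; rewrite !in_itv/= => /andP[h1 h2].
    have h : 0 < X / n.+3%:R by rewrite divr_gt0.
    by rewrite (lt_le_trans h h1)/= (le_lt_trans h2)// ltrBlDr ltrDl.
Qed.

Lemma exhausts_itv0y :
  exhausts `]0, +oo[%classic (fun n => n.+2%:R^-1) (fun n => n.+2%:R).
Proof.
split.
- by move=> m n mn; rewrite lef_pV2 ?posrE ?ltr0n// ler_nat.
- by move=> m n mn; rewrite ler_nat.
- by move=> n; rewrite (@lt_le_trans _ _ 1)// ?invf_lt1 ?ltr1n// ler1n.
- apply/seteqP; split => x /=.
  + rewrite in_itv/= andbT => x0.
    exists (Num.truncn (x + x^-1)) => //=; rewrite in_itv/=.
    have h : x + x^-1 <= (Num.truncn (x + x^-1)).+2%:R.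
      by rewrite ltW// (lt_trans (truncnS_gt _))// ltr_nat.
    apply/andP; split.
      by rewrite invf_ple ?posrE ?ltr0n// (le_trans _ h)// lerDr ltW.
    by rewrite (le_trans _ h)// lerDl invr_ge0 ltW.
  + by move=> [n _] /=; rewrite !in_itv/= andbT => /andP[h1 _]; apply: lt_le_trans h1.
Qed.

Lemma cvg_itvoo_left (X : R) : X / n.+3%:R @[n --> \oo] --> 0.
Proof.
rewrite -(mulr0 X); apply: cvgMr.
have := @cvg_harmonic R; rewrite -(cvg_shiftn 2); apply: cvg_trans.
by apply: near_eq_cvg; apply: nearW => n; rewrite /harmonic/= addn2.
Qed.

End real_integrals.

(** * Complex sequences and powers *)

Section complex_lemmas.
Context {R : realType}.
Implicit Types (x y z w : R[i]).

Lemma cReD x y : complex.Re (x + y) = complex.Re x + complex.Re y.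
Proof. by case: x; case: y. Qed.

Lemma cImD x y : complex.Im (x + y) = complex.Im x + complex.Im y.
Proof. by case: x; case: y. Qed.

Lemma cReN x : complex.Re (- x) = - complex.Re x.
Proof. by case: x. Qed.

Lemma cImN x : complex.Im (- x) = - complex.Im x.
Proof. by case: x. Qed.

Lemma cReM x y : complex.Re (x * y) =
  complex.Re x * complex.Re y - complex.Im x * complex.Im y.
Proof. by case: x; case: y. Qed.

Lemma cImM x y : complex.Im (x * y) =
  complex.Re x * complex.Im y + complex.Im x * complex.Re y.
Proof. by case: x => a b; case: y => c d /=. Qed.

Lemma cRe_nat n : complex.Re (n%:R : R[i]) = n%:R.
Proof. by rewrite -(rmorph_nat (real_complex R)). Qed.

Lemma cIm_nat n : complex.Im (n%:R : R[i]) = 0.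
Proof. by rewrite -(rmorph_nat (real_complex R)). Qed.

Lemma cRe_sum (u : nat -> R[i]) n :
  complex.Re (\sum_(k < n) u k) = \sum_(k < n) complex.Re (u k).
Proof.
by elim: n => [|n IH]; rewrite ?big_ord0// !big_ord_recr/= cReD IH.
Qed.

Lemma cIm_sum (u : nat -> R[i]) n :
  complex.Im (\sum_(k < n) u k) = \sum_(k < n) complex.Im (u k).
Proof.
by elim: n => [|n IH]; rewrite ?big_ord0// !big_ord_recr/= cImD IH.
Qed.

Lemma complex_eq x y :
  complex.Re x = complex.Re y -> complex.Im x = complex.Im y -> x = y.
Proof. by case: x; case: y => a b c d /= -> ->. Qed.

Lemma normc_ge0 x : 0 <= normc x.
Proof. by case: x => a b; exact: sqrtr_ge0. Qed.

Lemma normc_sqrtE x : normc x = Num.sqrt (complex.Re x ^+ 2 + complex.Im x ^+ 2).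
Proof. by case: x. Qed.

Lemma Re_le_normc x : `|complex.Re x| <= normc x.
Proof. by rewrite normc_sqrtE -sqrtr_sqr ler_wsqrtr// lerDl sqr_ge0. Qed.

Lemma Im_le_normc x : `|complex.Im x| <= normc x.
Proof. by rewrite normc_sqrtE -sqrtr_sqr ler_wsqrtr// lerDr sqr_ge0. Qed.

Lemma normc_le_ReIm x : normc x <= `|complex.Re x| + `|complex.Im x|.
Proof.
rewrite normc_sqrtE -[leRHS]ger0_norm ?addr_ge0// -sqrtr_sqr ler_wsqrtr//.
rewrite sqrrD !real_normK ?num_real// lerD2r lerDl.
by rewrite mulrn_wge0// mulr_ge0.
Qed.

Lemma normc_real (r : R) : normc r%:C = `|r|.
Proof. by rewrite normc_sqrtE/= expr0n addr0 sqrtr_sqr. Qed.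

Lemma normcX x n : normc (x ^+ n) = normc x ^+ n.
Proof. by elim: n => [|n IH]; rewrite ?expr0 ?normc1// !exprS normcM IH. Qed.

Lemma normc_sum (u : nat -> R[i]) n :
  normc (\sum_(k < n) u k) <= \sum_(k < n) normc (u k).
Proof.
elim: n => [|n IH]; first by rewrite !big_ord0 normc0.
by rewrite !big_ord_recr/= (le_trans (le_normcD _ _))// lerD2r.
Qed.

Lemma normc_eq0 x : (normc x == 0) = (x == 0).
Proof. by apply/eqP/eqP => [/eq0_normc|->] //; exact: normc0. Qed.

(** Convergence is stated componentwise so that limit theorems for real sequences apply; [ccvg_csum]
    is the bridge to the norm topology in which [csum] is defined. *)
Definition ccvg (u : nat -> R[i]) (l : R[i]) :=
  complex.Re (u n) @[n --> \oo] --> complex.Re l /\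
  complex.Im (u n) @[n --> \oo] --> complex.Im l.

Lemma ccvg_cst l : ccvg (fun=> l) l.
Proof. by split; exact: cvg_cst. Qed.

Lemma ccvgD (u v : nat -> R[i]) l m : ccvg u l -> ccvg v m -> ccvg (fun n => u n + v n) (l + m).
Proof.
move=> [ur ui] [vr vi]; split.
  by rewrite cReD; under eq_fun do rewrite cReD; exact: cvgD.
by rewrite cImD; under eq_fun do rewrite cImD; exact: cvgD.
Qed.

Lemma ccvgN (u : nat -> R[i]) l : ccvg u l -> ccvg (fun n => - u n) (- l).
Proof.
move=> [ur ui]; split.
  by rewrite cReN; under eq_fun do rewrite cReN; exact: cvgN.
by rewrite cImN; under eq_fun do rewrite cImN; exact: cvgN.
Qed.

Lemma ccvgM (u v : nat -> R[i]) l m : ccvg u l -> ccvg v m -> ccvg (fun n => u n * v n) (l * m).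
Proof.
move=> [ur ui] [vr vi]; split.
  by rewrite cReM; under eq_fun do rewrite cReM; apply: cvgB; exact: cvgM.
by rewrite cImM; under eq_fun do rewrite cImM; apply: cvgD; exact: cvgM.
Qed.

Lemma ccvgZ c (u : nat -> R[i]) l : ccvg u l -> ccvg (fun n => c * u n) (c * l).
Proof. by apply: ccvgM; exact: ccvg_cst. Qed.

Lemma ccvg_unique (u : nat -> R[i]) l m : ccvg u l -> ccvg u m -> l = m.
Proof.
move=> [ur ui] [vr vi]; apply: complex_eq.
  by rewrite -(cvg_lim (@Rhausdorff R) ur) -(cvg_lim (@Rhausdorff R) vr).
by rewrite -(cvg_lim (@Rhausdorff R) ui) -(cvg_lim (@Rhausdorff R) vi).
Qed.

Lemma ccvg_normc (u : nat -> R[i]) l : ccvg u l -> normc (u n) @[n --> \oo] --> normc l.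
Proof.
move=> [ur ui]; rewrite normc_sqrtE; under eq_fun do rewrite normc_sqrtE.
by apply: continuous_cvg; [exact: sqrt_continuous|apply: cvgD; exact: cvgM].
Qed.

Lemma ccvg0P (u : nat -> R[i]) : ccvg u 0 <-> normc (u n) @[n --> \oo] --> 0.
Proof.
split=> [/ccvg_normc|u0]; first by rewrite normc0.
split.
  apply: norm_cvg0; apply: (squeeze_cvgr _ (@cvg_cst _ _ _ _ _) u0).
  by apply: nearW => n; rewrite normr_ge0 Re_le_normc.
apply: norm_cvg0; apply: (squeeze_cvgr _ (@cvg_cst _ _ _ _ _) u0).
by apply: nearW => n; rewrite normr_ge0 Im_le_normc.
Qed.

Lemma ccvg_csum (u : nat -> R[i]) l : ccvg (fun n => \sum_(k < n) u k) l -> csum u = l.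
Proof.
move=> ul; rewrite /csum.
apply: (cvg_lim (@norm_hausdorff R[i] R[i]^o)).
apply/cvgrPdist_lt => e e0.
(* In the order of [R[i]] a positive radius is necessarily real. *)
have [eR e0'] : e = (complex.Re e)%:C /\ 0 < complex.Re e.
  by move: e0; rewrite ltcE/= => /andP[/eqP ei e0]; split => //; exact: complex_eq.
have /ccvg0P : ccvg (fun n => l - \sum_(k < n) u k) 0.
  by have := ccvgD (ccvg_cst l) (ccvgN ul); rewrite subrr.
move=> /cvgr0Pnorm_lt /(_ _ e0'); apply: filterS => n.
rewrite ger0_norm ?normc_ge0// => h.
rewrite eR /series/= big_mkord.
(* By conversion, the norm on [R[i]] is [normc] embedded into the complex numbers. *)
by rewrite -[ltLHS]/((normc (l - \sum_(k < n) u k))%:C) ltcR.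
Qed.

Lemma cpowRE (t : R) z : cpowR t z =
  (expR (complex.Re z * ln t) * cos (complex.Im z * ln t)) +i*
  (expR (complex.Re z * ln t) * sin (complex.Im z * ln t)).
Proof. by rewrite /cpowR; simpc. Qed.

Lemma normc_cpowR (t : R) z : normc (cpowR t z) = expR (complex.Re z * ln t).
Proof.
rewrite cpowRE normc_sqrtE/= !exprMn -mulrDr cos2Dsin2 mulr1 sqrtr_sqr.
by rewrite ger0_norm ?expR_ge0.
Qed.

Lemma cpowR_neq0 (t : R) z : cpowR t z != 0.
Proof. by rewrite -normc_eq0 normc_cpowR expR_eq0. Qed.

Lemma cpowRD (t : R) z w : cpowR t (z + w) = cpowR t z * cpowR t w.
Proof.
rewrite !cpowRE; apply: complex_eq => /=;
  rewrite cReD cImD !mulrDl expRD ?cosD ?sinD; ring.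
Qed.

Lemma cpowRM (s t : R) z : 0 < s -> 0 < t ->
  cpowR (s * t) z = cpowR s z * cpowR t z.
Proof.
move=> s0 t0; rewrite !cpowRE lnM ?posrE//; apply: complex_eq => /=;
  rewrite !mulrDr expRD ?cosD ?sinD; ring.
Qed.

Lemma cpowR0 (t : R) : cpowR t 0 = 1.
Proof. by rewrite cpowRE/= !mul0r expR0 cos0 sin0 mulr1 mulr0. Qed.

Lemma cpowR1l z : cpowR 1 z = 1.
Proof. by rewrite cpowRE/= ln1 !mulr0 expR0 cos0 sin0 mulr1 mulr0. Qed.

Lemma cpowR_real (t r : R) : cpowR t r%:C = (expR (r * ln t))%:C.
Proof. by rewrite cpowRE/= mul0r cos0 sin0 mulr1 mulr0. Qed.

Lemma cpowR1 (t : R) : 0 < t -> cpowR t 1 = t%:C.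
Proof. by move=> t0; rewrite -[1]/(1%:C) cpowR_real mul1r lnK. Qed.

Lemma cpowR_nat (t : R) n : 0 < t -> cpowR t n%:R = (t%:C) ^+ n.
Proof.
move=> t0; elim: n => [|n IH]; first by rewrite cpowR0 expr0.
by rewrite -addn1 natrD cpowRD IH cpowR1// addn1 exprSr.
Qed.

Lemma cpowRV (t : R) z : 0 < t -> cpowR t^-1 z = (cpowR t z)^-1.
Proof.
move=> t0; apply: (mulfI (cpowR_neq0 t z)).
rewrite mulfV ?cpowR_neq0// -cpowRM ?invr_gt0// mulfV ?gt_eqF//.
exact: cpowR1l.
Qed.

End complex_lemmas.

(** * Integration of complex-valued functions *)

Section complex_calculus.
Context {R : realType}.
Notation mu := (@lebesgue_measure R).
Implicit Types (D : set R) (f g F G : R -> R[i]) (t : R) (z w c : R[i]).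

(** The derivative along a real variable of a complex-valued function; no holomorphy is involved. *)
Definition is_cderive F t z :=
  is_derive t 1 (fun t => complex.Re (F t)) (complex.Re z) /\
  is_derive t 1 (fun t => complex.Im (F t)) (complex.Im z).

Lemma is_cderive_eq F t z w : is_cderive F t z -> z = w -> is_cderive F t w.
Proof. by move=> ? <-. Qed.

Lemma is_cderiveM F G t z w : is_cderive F t z -> is_cderive G t w ->
  is_cderive (fun t => F t * G t) t (z * G t + F t * w).
Proof.
move=> [Fr Fi] [Gr Gi]; split.
- rewrite [X in is_derive _ _ X _](_ : _ =
    (fun t => complex.Re (F t) * complex.Re (G t)) -
    (fun t => complex.Im (F t) * complex.Im (G t))); last first.
    by apply/funext => u; rewrite cReM.
  apply: is_derive_eq; rewrite cReD !cReM /GRing.scale/=; ring.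
- rewrite [X in is_derive _ _ X _](_ : _ =
    (fun t => complex.Re (F t) * complex.Im (G t)) +
    (fun t => complex.Im (F t) * complex.Re (G t))); last first.
    by apply/funext => u; rewrite cImM.
  apply: is_derive_eq; rewrite cImD !cImM /GRing.scale/=; ring.
Qed.

Lemma is_cderiveD F G t z w : is_cderive F t z -> is_cderive G t w ->
  is_cderive (fun t => F t + G t) t (z + w).
Proof.
move=> [Fr Fi] [Gr Gi]; split.
- rewrite [X in is_derive _ _ X _](_ : _ =
    (fun t => complex.Re (F t)) + (fun t => complex.Re (G t))); last first.
    by apply/funext => u; rewrite cReD.
  by rewrite cReD; exact: is_deriveD.
- rewrite [X in is_derive _ _ X _](_ : _ =
    (fun t => complex.Im (F t)) + (fun t => complex.Im (G t))); last first.
    by apply/funext => u; rewrite cImD.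
  by rewrite cImD; exact: is_deriveD.
Qed.

Lemma is_cderive_cst c t : is_cderive (fun=> c) t 0.
Proof. by split; exact: is_derive_cst. Qed.

Lemma is_derive_expR_ln (g : R -> R) (t dg a : R) : is_derive t 1 g dg -> 0 < g t ->
  is_derive t 1 (fun t => expR (a * ln (g t)))
    (a * (dg / g t) * expR (a * ln (g t))).
Proof.
move=> dgt gt0.
have dln : is_derive t 1 (@ln R \o g) (dg / g t).
  have dl := is_derive1_ln gt0.
  by apply: is_derive_eq; rewrite /GRing.scale/= mulrC.
have d1 : is_derive t 1 (fun t => a * ln (g t)) (a * (dg / g t)).
  by apply: (@is_deriveZ _ _ _ (@ln R \o g) a).
have d2 := is_derive_expR (a * ln (g t)).
have d3 : is_derive t 1 (@expR R \o (fun t => a * ln (g t)))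
    (a * (dg / g t) * expR (a * ln (g t))).
  by apply: is_derive_eq; rewrite /GRing.scale/= mulrC.
exact: d3.
Qed.

Lemma is_cderive_cpowR (g : R -> R) (t dg : R) z : is_derive t 1 g dg -> 0 < g t ->
  is_cderive (fun t => cpowR (g t) z) t ((dg / g t)%:C * z * cpowR (g t) z).
Proof.
move=> dgt gt0.
have dln : is_derive t 1 (@ln R \o g) (dg / g t).
  have dl := is_derive1_ln gt0.
  by apply: is_derive_eq; rewrite /GRing.scale/= mulrC.
have de a := is_derive_expR_ln a dgt gt0.
have dc b : is_derive t 1 (@cos R \o (fun t => b * ln (g t)))
    (- (b * (dg / g t) * sin (b * ln (g t)))).
  have d1 : is_derive t 1 (fun t => b * ln (g t)) (b * (dg / g t)).
    by apply: (@is_deriveZ _ _ _ (@ln R \o g) b).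
  have d2 := is_derive_cos (b * ln (g t)).
  by apply: is_derive_eq; rewrite /GRing.scale/=; ring.
have ds b : is_derive t 1 (@sin R \o (fun t => b * ln (g t)))
    (b * (dg / g t) * cos (b * ln (g t))).
  have d1 : is_derive t 1 (fun t => b * ln (g t)) (b * (dg / g t)).
    by apply: (@is_deriveZ _ _ _ (@ln R \o g) b).
  have d2 := is_derive_sin (b * ln (g t)).
  by apply: is_derive_eq; rewrite /GRing.scale/=; ring.
have := de (complex.Re z); have := dc (complex.Im z); have := ds (complex.Im z).
move=> dsz dcz dez; split.
- rewrite [X in is_derive _ _ X _](_ : _ =
    (fun t => expR (complex.Re z * ln (g t))) *
    (@cos R \o (fun t => complex.Im z * ln (g t)))); last first.
    by apply/funext => u; rewrite cpowRE.
  by apply: is_derive_eq; rewrite cpowRE !cReM cImM/= /GRing.scale/=; ring.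
- rewrite [X in is_derive _ _ X _](_ : _ =
    (fun t => expR (complex.Re z * ln (g t))) *
    (@sin R \o (fun t => complex.Im z * ln (g t)))); last first.
    by apply/funext => u; rewrite cpowRE.
  by apply: is_derive_eq; rewrite cpowRE !cImM !cReM/= /GRing.scale/=; ring.
Qed.

Lemma is_derive_continuous (h : R -> R) (t d : R) :
  is_derive t 1 h d -> {for t, continuous h}.
Proof.
by move=> [dh _]; apply: differentiable_continuous; exact/derivable1_diffP.
Qed.

Definition cmeasurable D f :=
  measurable_fun D (fun t => complex.Re (f t)) /\
  measurable_fun D (fun t => complex.Im (f t)).

Lemma cmeasurableD D f g : cmeasurable D f -> cmeasurable D g ->
  cmeasurable D (fun t => f t + g t).
Proof.
move=> [fr fi] [gr gi]; split.
  by under eq_fun do rewrite cReD; exact: measurable_funD.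
by under eq_fun do rewrite cImD; exact: measurable_funD.
Qed.

Lemma cmeasurableM D f g : cmeasurable D f -> cmeasurable D g ->
  cmeasurable D (fun t => f t * g t).
Proof.
move=> [fr fi] [gr gi]; split.
  by under eq_fun do rewrite cReM; apply: measurable_funB; exact: measurable_funM.
by under eq_fun do rewrite cImM; apply: measurable_funD; exact: measurable_funM.
Qed.

Lemma cmeasurable_cst D c : cmeasurable D (fun=> c).
Proof. by split; exact: measurable_cst. Qed.

Lemma cmeasurable_sum D (u : nat -> R -> R[i]) n :
  (forall k, cmeasurable D (u k)) ->
  cmeasurable D (fun t => \sum_(k < n) u k t).
Proof.
move=> mu_; elim: n => [|n IH].
  by under eq_fun do rewrite big_ord0; exact: cmeasurable_cst.
by under eq_fun do rewrite big_ord_recr/=; exact: cmeasurableD.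
Qed.

Lemma cmeasurable_cpowR D (h : R -> R) z : measurable D -> measurable_fun D h ->
  cmeasurable D (fun t => cpowR (h t) z).
Proof.
move=> mD mh.
have ml a : measurable_fun D (fun t => a * ln (h t)).
  apply: measurable_funM; first exact: measurable_cst.
  exact: (measurableT_comp (@measurable_ln R)).
have me a := measurableT_comp (@measurable_expR R) (ml a).
have mc a := measurableT_comp (continuous_measurable_fun (@continuous_cos R)) (ml a).
have ms a := measurableT_comp (continuous_measurable_fun (@continuous_sin R)) (ml a).
split; under eq_fun do rewrite cpowRE/=.
  by apply: measurable_funM; [exact: me|exact: mc].
by apply: measurable_funM; [exact: me|exact: ms].
Qed.

Lemma cintegrable_cmeasurable D f : cintegrable D f -> cmeasurable D f.
Proof.
by move=> [fr fi]; split; apply/measurable_EFinP;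
  [exact: measurable_int fr|exact: measurable_int fi].
Qed.

Lemma cintegrable_le D f (h : R -> R) : measurable D -> cmeasurable D f ->
  mu.-integrable D (EFin \o h) -> (forall t, D t -> normc (f t) <= h t) ->
  cintegrable D f.
Proof.
move=> mD [fr fi] ih fh; split; apply: (@le_integrable _ _ _ mu D mD _ (EFin \o h)) => //.
- by apply/measurable_EFinP; exact: fr.
- move=> t Dt /=; rewrite lee_fin (le_trans (Re_le_normc _))//.
  by rewrite (le_trans (fh _ Dt))// ler_norm.
- by apply/measurable_EFinP; exact: fi.
- move=> t Dt /=; rewrite lee_fin (le_trans (Im_le_normc _))//.
  by rewrite (le_trans (fh _ Dt))// ler_norm.
Qed.

(** The sum of the absolute values of the two parts stands in for the modulus: it dominates it by
    [normc_le_ReIm], and its integrability is immediate. *)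
Lemma integrable_normc D f : measurable D -> cintegrable D f ->
  mu.-integrable D (EFin \o (fun t => `|complex.Re (f t)| + `|complex.Im (f t)|)).
Proof.
by move=> mD [fr fi]; apply: integrable_EFinD => //; exact: integrable_norm.
Qed.

Lemma eq_cintegrable D f g : measurable D -> (forall t, D t -> f t = g t) ->
  cintegrable D f -> cintegrable D g.
Proof.
move=> mD fg [fr fi].
split; [apply: eq_integrable fr|apply: eq_integrable fi] => // t /set_mem Dt;
  by rewrite fg.
Qed.

Lemma eq_cintegral D f g : (forall t, D t -> f t = g t) ->
  cintegral D f = cintegral D g.
Proof.
by move=> fg; congr Complex; apply: eq_Rintegral => t /set_mem Dt; rewrite fg.
Qed.

Lemma cintegrableD D f g : measurable D -> cintegrable D f -> cintegrable D g ->
  cintegrable D (fun t => f t + g t).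
Proof.
move=> mD [fr fi] [gr gi]; split.
  by under eq_fun do rewrite cReD; exact: integrable_EFinD.
by under eq_fun do rewrite cImD; exact: integrable_EFinD.
Qed.

Lemma cintegralD D f g : measurable D -> cintegrable D f -> cintegrable D g ->
  cintegral D (fun t => f t + g t) = cintegral D f + cintegral D g.
Proof.
move=> mD [fr fi] [gr gi]; apply: complex_eq; rewrite /cintegral.
  rewrite cReD/= -RintegralD//; congr Rintegral.
  by apply/funext => t; rewrite cReD.
rewrite cImD/= -RintegralD//; congr Rintegral.
by apply/funext => t; rewrite cImD.
Qed.

Lemma cintegrableZ D f c : measurable D -> cintegrable D f ->
  cintegrable D (fun t => c * f t).
Proof.
move=> mD [fr fi]; split.
  under eq_fun do rewrite cReM.
  by apply: integrable_EFinB => //; exact: integrable_EFinZ.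
under eq_fun do rewrite cImM.
by apply: integrable_EFinD => //; exact: integrable_EFinZ.
Qed.

Lemma cintegralZ D f c : measurable D -> cintegrable D f ->
  cintegral D (fun t => c * f t) = c * cintegral D f.
Proof.
move=> mD [fr fi].
have iZ (a : R) (h : R -> R) := @integrable_EFinZ R D a h mD.
apply: complex_eq; rewrite /cintegral.
  rewrite cReM/= -!RintegralZl// -RintegralB//; [|exact: iZ|exact: iZ].
  by congr Rintegral; apply/funext => t; rewrite cReM.
rewrite cImM/= -!RintegralZl// -RintegralD//; [|exact: iZ|exact: iZ].
by congr Rintegral; apply/funext => t; rewrite cImM.
Qed.

Lemma cintegral_sum D (u : nat -> R -> R[i]) n : measurable D ->
  (forall k, cintegrable D (u k)) ->
  cintegrable D (fun t => \sum_(k < n) u k t) /\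
  cintegral D (fun t => \sum_(k < n) u k t) = \sum_(k < n) cintegral D (u k).
Proof.
move=> mD iu; elim: n => [|n [IH1 IH2]].
  under eq_fun do rewrite big_ord0; rewrite big_ord0; split.
    by split; exact: integrable0.
  by rewrite /cintegral/= /Rintegral integral0.
under eq_fun do rewrite big_ord_recr/=; rewrite big_ord_recr/= -IH2.
by split; [exact: cintegrableD|exact: cintegralD].
Qed.

Lemma dominated_cvg_cintegral D (u : nat -> R -> R[i]) f (h : R -> R) :
  measurable D -> (forall n, cmeasurable D (u n)) ->
  (forall t, D t -> ccvg (u ^~ t) (f t)) ->
  mu.-integrable D (EFin \o h) ->
  (forall n t, D t -> normc (u n t) <= h t) ->
  cintegrable D f /\ ccvg (fun n => cintegral D (u n)) (cintegral D f).
Proof.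
move=> mD mu_ uf ih uh.
have [rr rc] : mu.-integrable D (EFin \o (fun t => complex.Re (f t))) /\
    Rintegral mu D (fun t => complex.Re (u n t)) @[n --> \oo] -->
    Rintegral mu D (fun t => complex.Re (f t)).
  apply: (dominated_cvg_Rintegral
    (f_ := fun n t => complex.Re (u n t)) (g := h)) => //.
  - by move=> n; case: (mu_ n).
  - by move=> t Dt; case: (uf _ Dt).
  - by move=> n t Dt; rewrite (le_trans (Re_le_normc _))// uh.
have [ir ic] : mu.-integrable D (EFin \o (fun t => complex.Im (f t))) /\
    Rintegral mu D (fun t => complex.Im (u n t)) @[n --> \oo] -->
    Rintegral mu D (fun t => complex.Im (f t)).
  apply: (dominated_cvg_Rintegral
    (f_ := fun n t => complex.Im (u n t)) (g := h)) => //.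
  - by move=> n; case: (mu_ n).
  - by move=> t Dt; case: (uf _ Dt).
  - by move=> n t Dt; rewrite (le_trans (Im_le_normc _))// uh.
by split; split.
Qed.

(** The integrand is asked to be differentiable because the powers below come with their
    derivatives; this supplies the continuity of both parts. *)
Lemma cintegral_primitive D (a b : nat -> R) f F z w :
  exhausts D a b ->
  (forall t, D t -> exists d, is_cderive f t d) ->
  (forall t, D t -> is_cderive F t (f t)) ->
  cintegrable D f ->
  ccvg (F \o a) z -> ccvg (F \o b) w ->
  cintegral D f = w - z.
Proof.
move=> Dab cf dF [ir ii] [ar ai] [br bi].
apply: complex_eq; rewrite /cintegral/=.
  rewrite cReD cReN; apply: (Rintegral_primitive Dab
    (F := fun t => complex.Re (F t))) ar br => // t Dt.
    by have [d [dr _]] := cf t Dt; exact: is_derive_continuous dr.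
  by case: (dF t Dt).
rewrite cImD cImN; apply: (Rintegral_primitive Dab
    (F := fun t => complex.Im (F t))) ai bi => // t Dt.
  by have [d [_ di]] := cf t Dt; exact: is_derive_continuous di.
by case: (dF t Dt).
Qed.

End complex_calculus.

(** * Beta and gamma integrals *)

Section gamma.
Context {R : realType}.
Notation mu := (@lebesgue_measure R).

Lemma expR_mul_lnB1 (x t : R) : 0 < t ->
  expR ((x - 1) * ln t) = expR (x * ln t) / t.
Proof. by move=> t0; rewrite mulrBl mul1r expRB lnK. Qed.

Lemma integrable_powR_itv0 (x X : R) : 0 < x -> 0 < X ->
  mu.-integrable `]0, X[ (EFin \o (fun t => expR ((x - 1) * ln t))).
Proof.
move=> x0 X0.
apply: (integrable_bounded_primitive (exhausts_itvoo X0)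
  (F := fun t => x^-1 * expR (x * ln t)) _ _ (C := x^-1 * expR (x * ln X))).
- move=> t /=; rewrite in_itv/= => /andP[t0 _].
  exact: (is_derive_continuous (is_derive_expR_ln _ (is_derive_id t 1) t0)).
- move=> t /=; rewrite in_itv/= => /andP[t0 _].
  have d := is_derive_expR_ln x (is_derive_id t 1) t0.
  apply: (@is_derive_eq _ _ _ _ _ _ _ _ (is_deriveZ x^-1 d)).
  rewrite /GRing.scale/= expR_mul_lnB1//; field.
  by rewrite !gt_eqF.
- by move=> t _; exact: expR_ge0.
- move=> n; have n0 : 0 < X / n.+3%:R by rewrite divr_gt0.
  have [_ _ /(_ n) nX _] := exhausts_itvoo X0.
  rewrite lerBlDr (@le_trans _ _ (x^-1 * expR (x * ln X)))//.
    rewrite ler_pM2l ?invr_gt0// ler_expR ler_pM2l// ler_ln ?posrE//.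
      by rewrite lerBlDr lerDl ltW.
    exact: lt_trans nX.
  by rewrite lerDl mulr_ge0 ?invr_ge0 ?expR_ge0// ltW.
Qed.

(* [x / (t (1 + t)) (t / (1 + t)) ^ x] has the bounded primitive
   [(t / (1 + t)) ^ x] and dominates the integrand up to a constant. *)
Lemma integrable_Gamma (x : R) : 0 < x ->
  mu.-integrable `]0, +oo[ (EFin \o (fun t => expR ((x - 1) * ln t) * expR (- t))).
Proof.
move=> x0.
pose f t : R := x * (expR ((x - 1) * ln t) * expR ((- x - 1) * ln (1 + t))).
have d1 (t : R) : is_derive t 1 (fun t => 1 + t) 1.
  have d := is_deriveD (is_derive_cst (1 : R) t 1) (is_derive_id t 1).
  by apply: (is_derive_eq d); rewrite add0r.
have dE (a b t : R) : 0 < t -> is_derive t 1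
    (fun t => expR (a * ln t) * expR (b * ln (1 + t)))
    (expR (a * ln t) * expR (b * ln (1 + t)) * (a / t + b / (1 + t))).
  move=> t0; have t1 : 0 < 1 + t by rewrite addr_gt0.
  have da := is_derive_expR_ln a (is_derive_id t 1) t0.
  have db := is_derive_expR_ln b (d1 t) t1.
  apply: (is_derive_eq (is_deriveM da db)).
  by rewrite /GRing.scale/= !div1r; ring.
have mD := exhausts_measurable (exhausts_itv0y (R := R)).
have fi : mu.-integrable `]0, +oo[ (EFin \o f).
  apply: (integrable_bounded_primitive (exhausts_itv0y (R := R))
    (F := fun t => expR (x * ln t) * expR (- x * ln (1 + t))) _ _ (C := 1)).
  - move=> t /=; rewrite in_itv/= andbT => t0.
    exact: (is_derive_continuous (is_deriveZ x (dE _ _ _ t0))).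
  - move=> t /=; rewrite in_itv/= andbT => t0.
    have t1 : 0 < 1 + t by rewrite addr_gt0.
    apply: (is_derive_eq (dE _ _ _ t0)); rewrite /f !expR_mul_lnB1//.
    by field; rewrite !gt_eqF.
  - by move=> t _; rewrite /f mulr_ge0 ?mulr_ge0 ?expR_ge0// ltW.
  - move=> n; rewrite lerBlDr (@le_trans _ _ 1)//; last first.
      by rewrite lerDl mulr_ge0 ?expR_ge0.
    rewrite -expRD -[leRHS]expR0 ler_expR mulNr -mulrBr.
    rewrite -[leRHS](mulr0 x) ler_pM2l// subr_le0 ler_ln ?posrE ?addr_gt0//.
    by rewrite lerDr.
(* [M] is the maximum over t > 0 of (x + 1) ln (1 + t) - t, attained at t = x, so e^(-t) is at most
   e^M (1 + t)^(-x-1). The bound follows from ln u <= u - 1 at u = (1 + t) / (x + 1). *)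
pose M : R := (x + 1) * ln (x + 1) - x.
have gi := integrable_EFinZ (expR M / x) mD fi.
apply: (@le_integrable _ _ _ mu _ mD _ _ _ _ gi).
  apply/measurable_EFinP; apply: measurable_funM; last first.
    exact: (measurableT_comp (@measurable_expR R)) => //.
  apply: (measurableT_comp (@measurable_expR R)).
  by apply: measurable_funM; [exact: measurable_cst|exact: measurable_funTS (@measurable_ln R)].
move=> t; rewrite /= in_itv/= andbT => t0.
have t1 : 0 < 1 + t by rewrite addr_gt0.
have x1 : 0 < x + 1 by rewrite addr_gt0.
rewrite lee_fin ger0_norm ?mulr_ge0 ?expR_ge0// (le_trans _ (ler_norm _))//.
rewrite /f (_ : expR M / x * _ = expR ((x - 1) * ln t) *
  (expR M * expR ((- x - 1) * ln (1 + t)))); last by field; rewrite gt_eqF.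
rewrite ler_pM2l ?expR_gt0// -expRD ler_expR /M.
have : ln ((1 + t) / (x + 1)) <= (1 + t) / (x + 1) - 1.
  have := @le_ln1Dx R ((1 + t) / (x + 1) - 1).
  rewrite [X in ln X](_ : _ = (1 + t) / (x + 1)); last by ring.
  by apply; rewrite ltrBrDl subrr divr_gt0.
rewrite ln_div ?posrE// -(ler_pM2l x1) => h.
have E : (x + 1) * ((1 + t) / (x + 1) - 1) = t - x by field; rewrite gt_eqF.
move: h; rewrite E; lra.
Qed.

End gamma.

(** * The beta integral: integrability, recurrence and initial value *)

Section beta.
Context {R : realType}.
Notation mu := (@lebesgue_measure R).
Implicit Types (X t : R) (s v w z : R[i]).

Definition betaI X s v t : R[i] := cpowR t (s - 1) * cpowR (1 - t / X) v.

Definition betaJ X s v : R[i] := cintegral `]0, X[ (betaI X s v).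

Lemma itvoo_oneB X t : 0 < X -> 0 < t < X -> 0 < 1 - t / X < 1.
Proof.
move=> X0 /andP[t0 tX]; rewrite subr_gt0 ltr_pdivrMr// mul1r tX/=.
by rewrite ltrBlDr ltrDl divr_gt0.
Qed.

Lemma cmeasurable_betaI (D : set R) X s v : measurable D ->
  cmeasurable D (betaI X s v).
Proof.
move=> mD; apply: cmeasurableM; apply: cmeasurable_cpowR => //.
apply: measurable_funB; first exact: measurable_cst.
by apply: measurable_funM => //; exact: measurable_cst.
Qed.

(** As 1 - t/X lies between 0 and 1 and Re v >= 0, the second factor has modulus at most 1; only the
    singularity at 0 is left. *)
Lemma normc_betaI_le X s v t : 0 < X -> 0 <= complex.Re v -> 0 < t < X ->
  normc (betaI X s v t) <= expR ((complex.Re s - 1) * ln t).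
Proof.
move=> X0 v0 tX; have /andP[y0 y1] := itvoo_oneB X0 tX.
rewrite normcM !normc_cpowR cReD cReN/=.
rewrite -[leRHS]mulr1 ler_pM2l ?expR_gt0// -[leRHS]expR0 ler_expR.
by rewrite mulr_ge0_le0// ln_le0// ltW.
Qed.

Lemma cintegrable_betaI X s v : 0 < X -> 0 < complex.Re s -> 0 <= complex.Re v ->
  cintegrable `]0, X[ (betaI X s v).
Proof.
move=> X0 s0 v0.
apply: (cintegrable_le _ _ (integrable_powR_itv0 s0 X0)) => //.
  exact: cmeasurable_betaI.
by move=> t /=; rewrite in_itv/=; exact: normc_betaI_le.
Qed.

Lemma is_cderive_cpowR_id t z : 0 < t ->
  is_cderive (fun t => cpowR t z) t (t^-1%:C * z * cpowR t z).
Proof.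
by move=> t0; rewrite -div1r; apply: is_cderive_cpowR => //; exact: is_derive_id.
Qed.

Lemma is_cderive_cpowR_oneB X t z : 0 < X -> 0 < t < X ->
  is_cderive (fun t => cpowR (1 - t / X) z) t
    (- (X^-1 / (1 - t / X))%:C * z * cpowR (1 - t / X) z).
Proof.
move=> X0 tX; have /andP[y0 y1] := itvoo_oneB X0 tX.
have d : is_derive t 1 (fun t => 1 - t / X) (- X^-1).
  have d1 := is_deriveB (is_derive_cst (1 : R) t 1) (is_deriveZ X^-1 (is_derive_id t 1)).
  rewrite [X in is_derive _ _ X _](_ : _ = (cst 1 - X^-1 \*: id)).
    by apply: (is_derive_eq d1); rewrite sub0r /GRing.scale/= mulr1.
  by apply/funext => u; rewrite !fctE /= /GRing.scale/= mulrC.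
have := is_cderive_cpowR z d y0.
by rewrite mulNr (rmorphN (real_complex R)).
Qed.

Lemma is_cderive_betaI X s v t : 0 < X -> 0 < t < X ->
  exists d, is_cderive (betaI X s v) t d.
Proof.
move=> X0 tX; eexists; apply: is_cderiveM.
  by apply: is_cderive_cpowR_id; case/andP: tX.
exact: is_cderive_cpowR_oneB.
Qed.

Lemma cvg_expR_ln0 (x : R) (u : nat -> R) : 0 < x -> (forall n, 0 < u n) ->
  u n @[n --> \oo] --> 0 -> expR (x * ln (u n)) @[n --> \oo] --> 0.
Proof.
move=> x0 u0 cu.
rewrite (_ : (fun n => _) = (fun n => powR (u n) x)).
  by have /cvg_at_rightP := powR_cvg0 x0; apply; split.
by apply/funext => n; rewrite /powR gt_eqF.
Qed.

Lemma cpowRB1 t z : 0 < t -> cpowR t z = cpowR t (z - 1) * t%:C.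
Proof. by move=> t0; rewrite -(cpowR1 t0) -cpowRD subrK. Qed.

(** The function t^s (1 - t/X)^(v+1) vanishes at both ends. Writing t/X as 1 - (1 - t/X) in its
    derivative gives (s + v + 1) times the integrand for v + 1, minus (v + 1) times the one for
    v. *)
Lemma betaJ_succ X s v : 0 < X -> 0 < complex.Re s -> 0 <= complex.Re v ->
  (s + v + 1) * betaJ X s (v + 1) = (v + 1) * betaJ X s v.
Proof.
move=> X0 s0 v0; apply/eqP; rewrite -subr_eq0 -mulNr; apply/eqP.
have v1 : 0 <= complex.Re (v + 1) by rewrite cReD addr_ge0.
have mD : measurable `]0, X[%classic by [].
have i1 := cintegrable_betaI X0 s0 v1.
have i0 := cintegrable_betaI X0 s0 v0.
rewrite /betaJ -!cintegralZ// -cintegralD//; [|exact: cintegrableZ..].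
rewrite -[RHS](subrr 0).
apply: (cintegral_primitive (exhausts_itvoo X0)
  (F := fun t => cpowR t s * cpowR (1 - t / X) (v + 1))).
- move=> t /=; rewrite in_itv/= => tX.
  have [d1 r1] := is_cderive_betaI s (v + 1) X0 tX.
  have [d0 r0] := is_cderive_betaI s v X0 tX.
  by eexists; apply: is_cderiveD; apply: is_cderiveM;
    [exact: is_cderive_cst|exact: r1|exact: is_cderive_cst|exact: r0].
- move=> t /=; rewrite in_itv/= => tX.
  have /andP[y0 y1] := itvoo_oneB X0 tX; have /andP[t0 _] := tX.
  apply: (is_cderive_eq (is_cderiveM (is_cderive_cpowR_id s t0)
    (is_cderive_cpowR_oneB (v + 1) X0 tX))).
  rewrite /betaI (cpowRB1 s t0) (cpowRB1 (v + 1) y0) addrK.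
  set P := cpowR t _; set Q := cpowR _ v.
  have e1 : t^-1%:C * t%:C = 1 :> R[i] by rewrite -rmorphM/= mulVf ?gt_eqF.
  have e2 : t%:C * (X^-1 / (1 - t / X))%:C * (1 - t / X)%:C = 1 - (1 - t / X)%:C :> R[i].
    rewrite -!rmorphM/= -(rmorph1 (real_complex R)) -rmorphB/=; congr (_%:C).
    by field; rewrite !gt_eqF//; move: y0; rewrite subr_gt0 ltr_pdivrMr// mul1r subr_gt0.
  transitivity (P * Q * (s * (t^-1%:C * t%:C) * (1 - t / X)%:C -
    (v + 1) * (t%:C * (X^-1 / (1 - t / X))%:C * (1 - t / X)%:C))); first by ring.
  by rewrite e1 e2; ring.
- by apply: cintegrableD => //; exact: cintegrableZ.
- apply/ccvg0P; apply: (squeeze_cvgr _ (@cvg_cst _ _ _ _ _)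
    (cvg_expR_ln0 s0 (fun n => divr_gt0 X0 (ltr0Sn R n.+2)) (cvg_itvoo_left X))).
  apply: nearW => n; rewrite normc_ge0 andTb [comp _ _ _]/comp normcM !normc_cpowR.
  have [_ _ /(_ n) aX _] := exhausts_itvoo X0.
  have nX : 0 < X / n.+3%:R < X.
    by rewrite divr_gt0//= (lt_trans aX)// ltrBlDr ltrDl divr_gt0.
  have /andP[y0 y1] := itvoo_oneB X0 nX.
  rewrite -[leRHS]mulr1 ler_pM2l ?expR_gt0// -[leRHS]expR0 ler_expR.
  by rewrite mulr_ge0_le0// ln_le0// ltW.
(* At the right end 1 - t/X equals 1 / (n + 3), and the exponent v + 1 has positive real part even
   when Re v = 0, so the primitive tends to 0. *)
- apply/ccvg0P; have v1' : 0 < complex.Re (v + 1) by rewrite cReD ltr_wpDl.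
  have h : expR (complex.Re s * ln X) *
      expR (complex.Re (v + 1) * ln (n.+3%:R^-1)) @[n --> \oo] --> 0.
    rewrite -(mulr0 (expR (complex.Re s * ln X))); apply: cvgMr.
    apply: cvg_expR_ln0 => //.
    by have := cvg_itvoo_left (1 : R); under eq_fun do rewrite div1r.
  apply: (squeeze_cvgr _ (@cvg_cst _ _ _ _ _) h).
  apply: nearW => n; rewrite normc_ge0 andTb [comp _ _ _]/comp normcM !normc_cpowR.
  have n0 : 0 < X / n.+3%:R by rewrite divr_gt0.
  have [_ _ /(_ n) aX _] := exhausts_itvoo X0.
  rewrite (_ : 1 - (X - X / n.+3%:R) / X = n.+3%:R^-1).
    rewrite ler_pM2r ?expR_gt0// ler_expR ler_pM2l// ler_ln ?posrE//.
      by rewrite lerBlDr lerDl ltW.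
    exact: lt_trans aX.
  by rewrite mulrBl mulfV ?gt_eqF// (mulrAC X) mulfV ?gt_eqF// mul1r opprB addrC subrK.
Qed.

Lemma betaJ_0 X s : 0 < X -> 0 < complex.Re s -> s * betaJ X s 0 = cpowR X s.
Proof.
move=> X0 s0.
have mD : measurable `]0, X[%classic by [].
have i0 : cintegrable `]0, X[ (betaI X s 0) by exact: cintegrable_betaI.
rewrite /betaJ -cintegralZ// -[RHS]subr0.
apply: (cintegral_primitive (exhausts_itvoo X0) (F := fun t => cpowR t s)).
- move=> t /=; rewrite in_itv/= => tX.
  have [d0 r0] := is_cderive_betaI s 0 X0 tX.
  by eexists; apply: is_cderiveM; [exact: is_cderive_cst|exact: r0].
- move=> t /=; rewrite in_itv/= => /andP[t0 _].
  apply: (is_cderive_eq (is_cderive_cpowR_id s t0)).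
  rewrite /betaI cpowR0 mulr1 (cpowRB1 s t0).
  have e1 : t^-1%:C * t%:C = 1 :> R[i] by rewrite -rmorphM/= mulVf ?gt_eqF.
  by rewrite mulrAC mulrCA e1 mulr1 mulrC.
- exact: cintegrableZ.
- apply/ccvg0P; under eq_fun do rewrite [comp _ _ _]/comp normc_cpowR.
  by apply: (cvg_expR_ln0 (u := fun n => X / n.+3%:R)) => //;
    [move=> n; exact: divr_gt0|exact: cvg_itvoo_left].
- have [dr di] := is_cderive_cpowR_id s X0.
  have cX : X - X / n.+3%:R @[n --> \oo] --> X.
    rewrite -[X in _ --> X]subr0; apply: cvgB; first exact: cvg_cst.
    exact: cvg_itvoo_left.
  split; [have := is_derive_continuous dr|have := is_derive_continuous di];
    by move=> c; apply: (continuous_cvg _ c cX).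
Qed.

End beta.

(** * Scaling, Gauss's product and the beta-gamma identity *)

Section beta_gamma.
Context {R : realType}.
Notation mu := (@lebesgue_measure R).
Implicit Types (X t : R) (s v w z : R[i]).

Lemma Rintegral_scale_itvcc (G : R -> R) (X a b : R) : 0 < X -> a < b ->
  (forall t, X * a <= t <= X * b -> {for t, continuous G}) ->
  Rintegral mu `[X * a, X * b] G = Rintegral mu `[a, b] (fun t => G (X * t) * X).
Proof.
move=> X0 ab cG.
have dF (t : R) : is_derive t 1 ( *%R X) X.
  have d := is_deriveZ X (is_derive_id t 1).
  by apply: (is_derive_eq d); rewrite /GRing.scale/= mulr1.
have dE : ( *%R X)^`()%classic = cst X.
  by apply/funext => t; rewrite derive1E; case: (dF t).
have cF : continuous ( *%R X) by move=> t; exact: is_derive_continuous (dF t).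
rewrite /Rintegral (@integration_by_substitution_increasing _ _ _ _ _ (ltW ab)).
- by congr fine; apply: eq_integral => t _; rewrite dE.
- by move=> x y _ _; rewrite ltr_pM2l.
- by rewrite dE => x _; exact: cvg_cst.
- by rewrite dE; exact: is_cvg_cst.
- by rewrite dE; exact: is_cvg_cst.
- split.
  + by move=> t _; case: (dF t).
  + by apply: cvg_at_right_filter; exact: cF.
  + by apply: cvg_at_left_filter; exact: cF.
- apply: continuous_in_subspaceT => t /set_mem /=; rewrite in_itv/=.
  exact: cG.
Qed.

(** The map t -> X t carries the compact exhaustion of []0, 1[] to that of []0, X[], so the two
    approximating sequences agree term by term. *)
Lemma Rintegral_scale (G : R -> R) (X : R) : 0 < X ->
  (forall t, 0 < t < X -> {for t, continuous G}) ->
  mu.-integrable `]0, X[ (EFin \o G) ->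
  mu.-integrable `]0, 1[ (EFin \o (fun t => G (X * t) * X)) ->
  Rintegral mu `]0, X[ G = Rintegral mu `]0, 1[ (fun t => G (X * t) * X).
Proof.
move=> X0 cG iX i1.
have EX := exhausts_itvoo X0; have E1 := exhausts_itvoo (ltr01 : 0 < 1 :> R).
have hX := cvg_Rintegral_exhaustion (exhausts_measurable EX)
  (fun n => measurable_itv _) (exhausts_sub EX) (exhausts_near EX) iX.
have h1 := cvg_Rintegral_exhaustion (exhausts_measurable E1)
  (fun n => measurable_itv _) (exhausts_sub E1) (exhausts_near E1) i1.
rewrite -(cvg_lim (@Rhausdorff R) hX) -(cvg_lim (@Rhausdorff R) h1).
congr (lim (_ @ \oo)); apply/funext => n.
rewrite -(Rintegral_scale_itvcc X0); last 2 first.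
- by case: E1.
- move=> t tX.
  have /= := @exhausts_sub _ _ _ _ EX n t; rewrite !in_itv/= => h.
  apply: cG; apply: h; move: tX; by rewrite mulrBr !div1r mulr1.
by rewrite mulrBr !div1r mulr1.
Qed.

Lemma betaI_scale X s v t : 0 < X -> 0 < t ->
  betaI X s v (X * t) * X%:C = cpowR X s * betaI 1 s v t.
Proof.
move=> X0 t0; rewrite /betaI divr1 cpowRM// (_ : X * t / X = t).
  by rewrite (cpowRB1 s X0); ring.
by field; rewrite gt_eqF.
Qed.

Lemma betaJ_scale X s v : 0 < X -> 0 < complex.Re s -> 0 <= complex.Re v ->
  betaJ X s v = cpowR X s * betaJ 1 s v.
Proof.
move=> X0 s0 v0.
have mD : measurable `]0, (1 : R)[%classic by [].
have i1 := cintegrable_betaI (ltr01 : 0 < 1 :> R) s0 v0.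
have [rX jX] := cintegrable_betaI X0 s0 v0.
have [r1 j1] : cintegrable `]0, 1[ (fun t => betaI X s v (X * t) * X%:C).
  apply: eq_cintegrable (cintegrableZ (cpowR X s) mD i1) => // t /=.
  by rewrite in_itv/= => /andP[t0 _]; rewrite betaI_scale.
transitivity (cintegral `]0, 1[ (fun t => betaI X s v (X * t) * X%:C)); last first.
  rewrite /betaJ -cintegralZ//; apply: eq_cintegral => t /=.
  by rewrite in_itv/= => /andP[t0 _]; rewrite betaI_scale.
have RX z : complex.Re (z * X%:C) = complex.Re z * X by rewrite cReM/= mulr0 subr0.
have IX z : complex.Im (z * X%:C) = complex.Im z * X by rewrite cImM/= mulr0 add0r.
rewrite /betaJ /cintegral; congr Complex.
  rewrite [RHS](_ : _ = Rintegral mu `]0, 1[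
      (fun t => complex.Re (betaI X s v (X * t)) * X)); last first.
    by congr Rintegral; apply/funext => t; rewrite RX.
  apply: Rintegral_scale => //; last by apply: eq_integrable r1 => // t _; rewrite RX.
  move=> t tX; have [d [dr _]] := is_cderive_betaI s v X0 tX.
  exact: is_derive_continuous dr.
rewrite [RHS](_ : _ = Rintegral mu `]0, 1[
    (fun t => complex.Im (betaI X s v (X * t)) * X)); last first.
  by congr Rintegral; apply/funext => t; rewrite IX.
apply: Rintegral_scale => //; last by apply: eq_integrable j1 => // t _; rewrite IX.
move=> t tX; have [d [_ di]] := is_cderive_betaI s v X0 tX.
exact: is_derive_continuous di.
Qed.

Lemma Gamma_euler z : 0 < complex.Re z -> Gamma z = euler_integral z.
Proof.
move=> z0; rewrite /Gamma (_ : Num.truncn _ = 0%N).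
  by rewrite big_ord0 divr1 addr0.
apply/eqP; rewrite -leqn0 leqNgt truncn_gt_nat -ltNge.
by rewrite ltrBlDr ltrDl.
Qed.

(** With N = n + 1, ln (1 - u) <= -u gives the upper bound -t. For the lower one, -ln (1 - t/N) = ln
    (1 + t/(N - t)) <= t/(N - t), and N t/(N - t) = t + t^2/(N - t). *)
Lemma cvg_ln_oneB_seq t : 0 < t ->
  n.+1%:R * ln (1 - t / n.+1%:R) @[n --> \oo] --> - t.
Proof.
move=> t0.
have l : - t - t ^+ 2 * 2 / n.+1%:R @[n --> \oo] --> - t.
  rewrite -[X in _ --> X]subr0; apply: cvgB; first exact: cvg_cst.
  rewrite -(mulr0 (t ^+ 2 * 2)); apply: cvgMr; exact: cvg_harmonic.
apply: (squeeze_cvgr _ l (@cvg_cst _ _ _ _ _)).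
(* Once N > 2t, N - t is at least N/2, which explains the factor 2 in the lower bound. *)
exists (Num.truncn (2 * t)) => // n /= tn.
have N0 : 0 < n.+1%:R :> R by rewrite ltr0n.
have hN : 2 * t < n.+1%:R.
  by rewrite (lt_le_trans (truncnS_gt _))// ler_nat.
move: (n.+1%:R : R) N0 hN => N N0 hN.
have tN : 0 < N - t by lra.
have y0 : 0 < 1 - t / N by rewrite subr_gt0 ltr_pdivrMr// mul1r; lra.
apply/andP; split; last first.
  rewrite -ler_pdivlMl// mulrN [in leRHS]mulrC.
  by apply: le_ln1Dx; rewrite ltrN2 ltr_pdivrMr// mul1r; lra.
have : - ln (1 - t / N) <= t / (N - t).
  rewrite -lnV ?posrE// (_ : (1 - t / N)^-1 = 1 + t / (N - t)).
    by apply: le_ln1Dx; apply: (@lt_trans _ _ 0) => //; rewrite divr_gt0.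
  by field; rewrite !gt_eqF.
move=> h; rewrite -(ler_pM2l N0) mulrN in h.
have : N * (t / (N - t)) <= t + t ^+ 2 * 2 / N; last by lra.
rewrite mulrA ler_pdivrMr// -(ler_pM2l N0).
rewrite [leRHS](_ : _ = (N * t + t ^+ 2 * 2) * (N - t)).
  by nra.
by field; rewrite gt_eqF.
Qed.

Lemma cvg_ln_oneB_seq0 t : 0 < t ->
  ln (1 - t / n.+1%:R) @[n --> \oo] --> 0.
Proof.
move=> t0; rewrite -(mul0r (- t)).
rewrite (_ : (fun n => _) =
    (fun n => harmonic n * (n.+1%:R * ln (1 - t / n.+1%:R)))).
  by apply: cvgM; [exact: cvg_harmonic|exact: cvg_ln_oneB_seq].
by apply/funext => n; rewrite /harmonic/= mulrA mulVf ?mul1r// pnatr_eq0.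
Qed.

(** Euler's integrand is itself the majorant, because N ln (1 - t/N) <= -t and Re w >= 0. The offset
    [w] disappears in the limit; it is present because the beta-gamma identity needs the exponent v
    + n + 2 over the interval of length n + 1. *)
Lemma betaJ_cvg_Gamma s w : 0 < complex.Re s -> 0 <= complex.Re w ->
  ccvg (fun n => betaJ n.+1%:R s (w + n.+1%:R)) (Gamma s).
Proof.
move=> s0 w0; rewrite Gamma_euler// /euler_integral.
(* Extension by 0 turns integrals over growing intervals into integrals over the fixed half-line. *)
pose u n t : R[i] := if t < n.+1%:R then betaI n.+1%:R s (w + n.+1%:R) t else 0.
have mD := exhausts_measurable (exhausts_itv0y (R := R)).
have uE n (P : R[i] -> R) : P 0 = 0 ->
    Rintegral mu `]0, n.+1%:R[ (fun t => P (betaI n.+1%:R s (w + n.+1%:R) t)) =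
    Rintegral mu `]0, +oo[ (fun t => P (u n t)).
  move=> P0.
  rewrite (_ : `]0, n.+1%:R[%classic = `]0, +oo[%classic `&` `]-oo, n.+1%:R[%classic).
    rewrite Rintegral_mkcondr; congr Rintegral; apply/funext => t.
    by rewrite patchE mem_setE in_itv/= /u; case: ifP.
  apply/seteqP; split => t /=; rewrite !in_itv/=.
    by move=> /andP[-> ->].
  by rewrite andbT => -[-> ->].
rewrite (_ : (fun n => _) = (fun n => cintegral `]0, +oo[ (u n))); last first.
  by apply/funext => n; rewrite /betaJ /cintegral (uE n (@complex.Re R))// (uE n (@complex.Im R)).
apply: (proj2 (A := cintegrable `]0, +oo[
  (fun t => cpowR t (s - 1) * (expR (- t))%:C))).
apply: (dominated_cvg_cintegral mD _ _ (integrable_Gamma s0)).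
- move=> n; have mN : measurable `]-oo, (n.+1%:R : R)[%classic by [].
  have [hr hi] := @cmeasurable_betaI R _ n.+1%:R s (w + n.+1%:R)
    (measurableI _ _ mD mN).
  split.
    rewrite (_ : (fun t => _) =
        (fun t => complex.Re (betaI n.+1%:R s (w + n.+1%:R) t)) \_ `]-oo, n.+1%:R[).
      exact/(measurable_restrict _ mN mD).
    by apply/funext => t; rewrite patchE mem_setE in_itv/= /u; case: ifP.
  rewrite (_ : (fun t => _) =
      (fun t => complex.Im (betaI n.+1%:R s (w + n.+1%:R) t)) \_ `]-oo, n.+1%:R[).
    exact/(measurable_restrict _ mN mD).
  by apply/funext => t; rewrite patchE mem_setE in_itv/= /u; case: ifP.
- move=> t /=; rewrite in_itv/= andbT => t0.
  have h : ccvg (fun n => cpowR (1 - t / n.+1%:R) (w + n.+1%:R)) (expR (- t))%:C.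
    pose L n := ln (1 - t / n.+1%:R) : R.
    have cL : L n @[n --> \oo] --> 0 := cvg_ln_oneB_seq0 t0.
    have cI : complex.Im w * L n @[n --> \oo] --> 0.
      by rewrite -(mulr0 (complex.Im w)); exact: cvgMr.
    have cR : expR (complex.Re w * L n + n.+1%:R * L n) @[n --> \oo] --> expR (- t).
      apply: continuous_cvg; first exact: continuous_expR.
      rewrite -[X in _ --> X]add0r; apply: cvgD; last exact: cvg_ln_oneB_seq.
      by rewrite -(mulr0 (complex.Re w)); exact: cvgMr.
    have -> : (fun n => cpowR (1 - t / n.+1%:R) (w + n.+1%:R)) = (fun n =>
        (expR (complex.Re w * L n + n.+1%:R * L n) * cos (complex.Im w * L n)) +i*
        (expR (complex.Re w * L n + n.+1%:R * L n) * sin (complex.Im w * L n))).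
      apply/funext => n; rewrite cpowRE cReD cImD cRe_nat cIm_nat addr0.
      by rewrite mulrDl.
    have cC : cos (complex.Im w * L n) @[n --> \oo] --> (1 : R).
      rewrite -(@cos0 R); apply: continuous_cvg => //; exact: continuous_cos.
    have cS : sin (complex.Im w * L n) @[n --> \oo] --> (0 : R).
      rewrite -[X in _ --> X](@sin0 R).
      by apply: continuous_cvg => //; exact: continuous_sin.
    split => /=.
      by rewrite -[X in _ --> X]mulr1; exact: cvgM.
    by rewrite -(mulr0 (expR (- t))); exact: cvgM.
  have [hr hi] := ccvgZ (cpowR t (s - 1)) h.
  have tn : \forall n \near \oo, t < n.+1%:R.
    exists (Num.truncn t) => // n /= tn.
    by rewrite (lt_le_trans (truncnS_gt _))// ler_nat.
  split; [move: hr|move: hi]; apply: cvg_trans; apply: near_eq_cvg;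
    by apply: filterS tn => n tn; rewrite /u tn.
- move=> n t /=; rewrite in_itv/= andbT => t0; rewrite /u.
  case: ifPn => tn; last by rewrite normc0 mulr_ge0 ?expR_ge0.
  have N0 : 0 < n.+1%:R :> R by rewrite ltr0n.
  have tN : 0 < t < n.+1%:R by rewrite t0.
  have /andP[y0 y1] := itvoo_oneB N0 tN.
  rewrite normcM !normc_cpowR cReD cReN/= ler_pM2l ?expR_gt0// ler_expR.
  rewrite cReD cRe_nat mulrDl.
  have h1 : complex.Re w * ln (1 - t / n.+1%:R) <= 0.
    by rewrite mulr_ge0_le0// ln_le0// ltW.
  have h2 : ln (1 - t / n.+1%:R) <= - (t / n.+1%:R).
    by apply: le_ln1Dx; rewrite ltrN2 ltr_pdivrMr// mul1r.
  rewrite -(ler_pM2l N0) in h2.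
  have E : n.+1%:R * - (t / n.+1%:R) = - t by field; rewrite gt_eqF.
  by rewrite E in h2; lra.
Qed.

(** The rising factorial, or Pochhammer symbol. *)
Definition poch z n : R[i] := \prod_(j < n) (z + j%:R).

Lemma poch_neq0 z n : 0 < complex.Re z -> poch z n != 0.
Proof.
move=> z0; apply/prodf_neq0 => j _; apply/eqP => /(congr1 (@complex.Re R)).
by rewrite cReD cRe_nat => /eqP; rewrite /= gt_eqF// ltr_wpDr.
Qed.

Lemma betaJ_poch X s v n : 0 < X -> 0 < complex.Re s -> 0 <= complex.Re v ->
  poch (s + v + 1) n * betaJ X s (v + n%:R) = poch (v + 1) n * betaJ X s v.
Proof.
move=> X0 s0 v0; elim: n => [|n IH]; first by rewrite /poch !big_ord0 addr0.
have vn : 0 <= complex.Re (v + n%:R) by rewrite cReD cRe_nat addr_ge0.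
have := betaJ_succ X0 s0 vn.
rewrite /poch !big_ord_recr/= -/(poch _ _) -/(poch _ _) => h.
rewrite -addn1 natrD addrA -mulrA.
rewrite [s + v + 1 + _](_ : _ = s + (v + n%:R) + 1); last by ring.
by rewrite h mulrCA IH; ring.
Qed.

(** The recurrence is started at v = 0, where J_X(z, 0) = X^z / z. With X = n and n tending to
    infinity this is Gauss's formula, Gamma(z) as the limit of n! n^z / (z (z + 1) ... (z + n)). *)
Lemma Gauss_product X n z : 0 < X -> 0 < complex.Re z ->
  poch z n.+1 * betaJ X z n%:R = n`!%:R * cpowR X z.
Proof.
move=> X0 z0; have := betaJ_poch n X0 z0 (lexx (complex.Re 0)).
rewrite addr0 add0r => h.
have -> : poch z n.+1 = z * poch (z + 1) n.
  rewrite /poch big_ord_recl addr0; congr (_ * _); apply: eq_bigr => j _.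
  by rewrite -addrA -(natrD _ 1).
have f1 : poch 1 n = n`!%:R.
  rewrite /poch; elim: n {h} => [|n IH]; first by rewrite big_ord0.
  by rewrite big_ord_recr/= IH factS mulnC natrM -(natrD _ 1).
rewrite -mulrA h add0r f1 mulrCA betaJ_0//.
Qed.

(** For each N = n + 1, J_1(s, v) J_N(s + v + 1, N) = J_N(v + 1, N) J_N(s, v + N + 1): multiplied by
    the rising factorials of order N + 1 of s + v + 1 and v + 1, both sides reduce to the same
    expression by [Gauss_product], [betaJ_poch] and scaling. Each factor depending on N tends to a
    gamma value. *)
Lemma betaJ_Gamma1 s v : 0 < complex.Re s -> 0 <= complex.Re v ->
  betaJ 1 s v * Gamma (s + v + 1) = Gamma (v + 1) * Gamma s.
Proof.
move=> s0 v0.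
have v1 : 0 < complex.Re (v + 1) by rewrite cReD ltr_wpDl.
have z0 : 0 < complex.Re (s + v + 1) by rewrite -addrA cReD addr_gt0.
have cs : ccvg (fun n => betaJ n.+1%:R s (v + n.+2%:R)) (Gamma s).
  have := betaJ_cvg_Gamma s0 (ltW v1).
  by under [X in ccvg X]eq_fun do rewrite -addrA -(natrD _ 1).
have cG w : 0 < complex.Re w -> ccvg (fun n => betaJ n.+1%:R w n.+1%:R) (Gamma w).
  move=> w0; have := betaJ_cvg_Gamma w0 (lexx (complex.Re 0)).
  by under [X in ccvg X]eq_fun do rewrite add0r.
apply: (@ccvg_unique _ (fun n => betaJ 1 s v * betaJ n.+1%:R (s + v + 1) n.+1%:R)).
  by apply: ccvgZ; exact: cG.
rewrite (_ : (fun n => _) = (fun n => betaJ n.+1%:R (v + 1) n.+1%:R *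
    betaJ n.+1%:R s (v + n.+2%:R))).
  by apply: ccvgM => //; exact: cG.
apply/funext => n; have N0 := ltr0Sn R n.
apply: (mulfI (poch_neq0 n.+2 z0)); apply: (mulfI (poch_neq0 n.+2 v1)).
have vn : 0 <= complex.Re (v + n.+2%:R) by rewrite cReD cRe_nat addr_ge0.
transitivity ((poch (v + 1) n.+2 * betaJ 1 s v) *
  (poch (s + v + 1) n.+2 * betaJ n.+1%:R (s + v + 1) n.+1%:R)); first by ring.
transitivity ((poch (v + 1) n.+2 * betaJ n.+1%:R (v + 1) n.+1%:R) *
  (poch (s + v + 1) n.+2 * betaJ n.+1%:R s (v + n.+2%:R))); last by ring.
rewrite !Gauss_product// -(betaJ_poch n.+2 ltr01)// (betaJ_scale N0 s0 vn).
by rewrite -addrA !cpowRD; ring.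
Qed.

(** Gauss's product at z = 1 gives J_N(1, N) = N / (N + 1), which tends to 1. *)
Lemma Gamma1 : Gamma (1 : R[i]) = 1.
Proof.
apply: (@ccvg_unique _ (fun n => betaJ n.+1%:R 1 n.+1%:R)).
  have := @betaJ_cvg_Gamma 1 0 ltr01 (lexx _).
  by under [X in ccvg X]eq_fun do rewrite add0r.
rewrite (_ : (fun n => _) = (fun n => (1 - n.+2%:R^-1)%:C)).
  split; last exact: cvg_cst.
  rewrite /= -[X in _ --> X]subr0; apply: cvgB; first exact: cvg_cst.
  have := @cvg_harmonic R; rewrite -(cvg_shiftn 1); apply: cvg_trans.
  by apply: near_eq_cvg; apply: nearW => n; rewrite /harmonic/= addn1.
apply/funext => n; have N0 := ltr0Sn R n.
have := @Gauss_product n.+1%:R n.+1 1 N0 ltr01.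
have -> : poch 1 n.+2 = n.+2%:R * n.+1`!%:R.
  rewrite -natrM -factS /poch; elim: n.+2 => [|m IH]; first by rewrite big_ord0.
  by rewrite big_ord_recr/= IH factS mulnC natrM -(natrD _ 1).
rewrite cpowR1// (rmorph_nat (real_complex R)) => h.
have f0 : n.+1`!%:R != 0 :> R[i] by rewrite pnatr_eq0 -lt0n fact_gt0.
have n0 : n.+2%:R != 0 :> R[i] by rewrite pnatr_eq0.
apply: (mulfI f0); apply: (mulfI n0).
rewrite mulrA h rmorphB rmorph1/= (fmorphV (real_complex R)) (rmorph_nat (real_complex R)).
by rewrite mulrCA mulrBr mulr1 mulfV// -[n.+2%:R]natr1 addrK.
Qed.

Lemma betaJ10 s : 0 < complex.Re s -> betaJ 1 s 0 = s^-1.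
Proof.
move=> s0; have sn0 : s != 0 by apply: contraTneq s0 => ->; rewrite ltxx.
by apply: (mulfI sn0); rewrite betaJ_0// cpowR1l mulfV.
Qed.

(** This is the beta-gamma identity at v = 0, where J_1(z, 0) = 1/z. *)
Lemma GammaS z : 0 < complex.Re z -> Gamma (z + 1) = z * Gamma z.
Proof.
move=> z0; have zn0 : z != 0 by apply: contraTneq z0 => ->; rewrite ltxx.
have := betaJ_Gamma1 z0 (lexx (complex.Re 0)).
rewrite addr0 add0r Gamma1 mul1r betaJ10// => <-.
by rewrite mulrA mulfV// mul1r.
Qed.

Lemma Gamma_nat n : Gamma (n.+1%:R : R[i]) = n`!%:R.
Proof.
elim: n => [|n IH]; first exact: Gamma1.
by rewrite -natr1 GammaS ?cRe_nat// IH factS natrM.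
Qed.

End beta_gamma.

(** * Zeros of the gamma function *)

Section gamma_neq0.
Context {R : realType}.
Notation mu := (@lebesgue_measure R).
Implicit Types (x t : R) (s v w z : R[i]).

Lemma sin_le_id t : 0 <= t -> sin t <= t.
Proof.
move=> t0.
have [c _] := @MVT_segment R (@sin R) (@cos R) 0 t t0 (fun u _ => is_derive_sin u)
  (continuous_subspaceT (@continuous_sin R)).
rewrite sin0 !subr0 => ->; rewrite -[leRHS]mul1r ler_wpM2r// cos_le1//.
Qed.

Lemma normr_sin_le t : `|sin t| <= `|t|.
Proof.
wlog t0 : t / 0 <= t => [h|].
  by have [/h//|/ltW t0] := leP 0 t; rewrite -normrN -sinN -(normrN t) h// oppr_ge0.
rewrite (ger0_norm t0) ler_norml sin_le_id// andbT.
have [t1|t1] := leP 1 t; first by rewrite (le_trans _ (sin_geN1 t))// lerN2.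
rewrite (@le_trans _ _ 0)//; first by rewrite oppr_le0.
apply: sin_ge0_pi; rewrite t0/= (le_trans (ltW t1))//.
by rewrite (le_trans _ (pi_ge2 R))// ler1n.
Qed.

(** Half-angle formula: 1 - cos t = 2 sin^2 (t/2), which is at most t^2/2. *)
Lemma cos_ge_quadratic t : 1 - t ^+ 2 / 2 <= cos t.
Proof.
have -> : cos t = 1 - 2 * sin (t / 2) ^+ 2.
  rewrite [in LHS](splitr t) -mulr2n cos_mulr2n.
  by have := cos2Dsin2 (t / 2); move: (cos _ ^+ 2) (sin _ ^+ 2) => a b; lra.
have := normr_sin_le (t / 2).
rewrite -ler_sqr ?nnegrE// !real_normK ?num_real//.
move: (sin _ ^+ 2) => a; lra.
Qed.

(** With u = ln t / 2 the right side is 4 (e^u - e^(-u))^2, and e^u - e^(-u) is at least u in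
    absolute value. This trades the logarithm for t and 1/t, whose moments against the gamma
    integrand the functional equation evaluates. *)
Lemma sqr_ln_le t : 0 < t -> ln t ^+ 2 <= 4 * (t - 2 + t^-1).
Proof.
move=> t0.
have -> : t - 2 + t^-1 = (expR (ln t / 2) - expR (- (ln t / 2))) ^+ 2.
  have : expR (ln t / 2) ^+ 2 = t by rewrite -expRM_natl mulrC divfK// lnK.
  rewrite expRN; move: (expR _) (expR_gt0 (ln t / 2)) => e e0 <-.
  by field; rewrite gt_eqF.
set u := ln t / 2; have -> : ln t = 2 * u by rewrite /u; field.
have h1 := expR_ge1Dx u; have h2 := expR_ge1Dx (- u).
have [u0|u0] := leP 0 u.
  have h3 : expR (- u) <= 1 by rewrite expR_le1 oppr_le0.
  by rewrite exprMn; nra.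
have h3 : expR u <= 1 by rewrite expR_le1 ltW.
by rewrite exprMn; nra.
Qed.

Let h x t := expR ((x - 1) * ln t) * expR (- t).
Let G x := Rintegral mu `]0, +oo[ (h x).

Let mD : measurable (`]0, +oo[%classic : set R).
Proof. exact: (exhausts_measurable (exhausts_itv0y (R := R))). Qed.

Let hi x : 0 < x -> mu.-integrable `]0, +oo[ (EFin \o h x).
Proof. by move=> x0; exact: integrable_Gamma. Qed.

Let Gamma_real x : 0 < x -> Gamma x%:C = (G x)%:C.
Proof.
move=> x0; rewrite Gamma_euler// /euler_integral.
have e t : cpowR t (x%:C - 1) * (expR (- t))%:C = (h x t)%:C.
  by rewrite -(rmorph1 (real_complex R)) -rmorphB/= cpowR_real -rmorphM.
rewrite (_ : (fun t => _) = (fun t => (h x t)%:C)); last exact/funext.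
by rewrite /cintegral /Rintegral/= integral0.
Qed.

Let GS x : 0 < x -> G (x + 1) = x * G x.
Proof.
move=> x0; apply: (@complexI R); rewrite [RHS]rmorphM/= -!Gamma_real ?addr_gt0//.
by rewrite rmorphD rmorph1 GammaS.
Qed.

(** On [[1, 2]] the factor t^(x-1) is at least 1, as x >= 1, and e^(-t) is at least e^(-2). *)
Let G_gt0 x : 1 <= x -> 0 < G x.
Proof.
move=> x1; have x0 : 0 < x by rewrite (lt_le_trans ltr01).
have D12 : `[1, 2]%classic `<=` (`]0, +oo[%classic : set R).
  by move=> t /=; rewrite !in_itv/= andbT => /andP[t1 _]; rewrite (lt_le_trans ltr01).
apply: (@lt_le_trans _ _ (expR (- 2))); first exact: expR_gt0.
rewrite -lee_fin /G /Rintegral fineK; last exact: integrable_fin_num (hi x0).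
apply: (@le_trans _ _ (\int[mu]_(t in `[1%R, 2%R]) (h x t)%:E)%E); last first.
  apply: ge0_subset_integral => //.
    by apply: measurable_int (hi x0).
  by move=> t _; rewrite lee_fin mulr_ge0 ?expR_ge0.
have mh : measurable_fun (`[1, 2]%classic : set R) (EFin \o h x).
  by apply: measurable_funS (measurable_int _ (hi x0)).
apply: (@le_trans _ _ (\int[mu]_(t in `[1%R, 2%R]) (expR (- 2))%:E)%E).
  rewrite integral_cst//= lebesgue_measure_itv/= lte_fin ltr1n -EFinD.
  by rewrite (_ : 2 - 1 = 1)%R ?mule1//; ring.
apply: ge0_le_integral => //.
move=> t; rewrite /= in_itv/= => /andP[t1 t2]; rewrite lee_fin /h.
rewrite -[leLHS]mul1r ler_pM// ?expR_ge0 ?ler_expR ?lerN2//.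
by rewrite -[leLHS]expR0 ler_expR mulr_ge0 ?subr_ge0 ?ln_ge0.
Qed.

(* For real [x] large against [y], the mass [t ^ (x - 1) e ^ (- t)] concentrates
   near [t = x], where [(t / x) ^ (i y)] is close to [1]. *)
Lemma Gamma_neq0_large z : 2 + 2 * complex.Im z ^+ 2 < complex.Re z ->
  Gamma z != 0.
Proof.
set x := complex.Re z; set y := complex.Im z => xy.
have y2 : 0 <= y ^+ 2 := sqr_ge0 y.
have x0 : 0 < x by lra.
have x10 : 0 < x - 1 by lra.
apply/eqP; rewrite Gamma_euler// => E0.
have RE t : complex.Re (cpowR t (z - 1) * (expR (- t))%:C) = h x t * cos (y * ln t).
  by rewrite cReM cpowRE !(cReD, cReN, cImD, cImN)/= mulr0 !subr0 -/x -/y /h; ring.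
have IE t : complex.Im (cpowR t (z - 1) * (expR (- t))%:C) = h x t * sin (y * ln t).
  by rewrite cImM cpowRE !(cReD, cReN, cImD, cImN)/= mulr0 subr0 add0r -/x -/y /h; ring.
have c0 : Rintegral mu `]0, +oo[ (fun t => h x t * cos (y * ln t)) = 0.
  transitivity (Rintegral mu `]0, +oo[
      (fun t => complex.Re (cpowR t (z - 1) * (expR (- t))%:C))).
    by apply: eq_Rintegral => t _; rewrite RE.
  exact: (congr1 (@complex.Re R) E0).
have s0 : Rintegral mu `]0, +oo[ (fun t => h x t * sin (y * ln t)) = 0.
  transitivity (Rintegral mu `]0, +oo[
      (fun t => complex.Im (cpowR t (z - 1) * (expR (- t))%:C))).
    by apply: eq_Rintegral => t _; rewrite IE.
  exact: (congr1 (@complex.Im R) E0).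
have ml : measurable_fun (`]0, +oo[%classic : set R) (fun t => y * ln t).
  apply: measurable_funM; first exact: measurable_cst.
  exact: measurable_funTS (@measurable_ln R).
have mh : measurable_fun (`]0, +oo[%classic : set R) (h x).
  by apply/measurable_EFinP; exact: measurable_int (hi x0).
have h0 t : 0 <= h x t by rewrite mulr_ge0 ?expR_ge0.
have ib (f : R -> R) : measurable_fun (`]0, +oo[%classic : set R) f -> (forall t, `|f t| <= 1) ->
    mu.-integrable `]0, +oo[ (EFin \o (fun t => h x t * f t)).
  move=> mf f1; apply: (@le_integrable _ _ _ mu _ mD _ _ _ _ (hi x0)).
    by apply/measurable_EFinP; exact: measurable_funM.
  by move=> t _; rewrite /= lee_fin normrM ler_piMr.
have ic := ib _ (measurableT_comp (continuous_measurable_fun (@continuous_cos R)) ml)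
  (fun t => cos_max _).
have is_ := ib _ (measurableT_comp (continuous_measurable_fun (@continuous_sin R)) ml)
  (fun t => sin_max _).
(* If Gamma z = 0, the cosine and sine integrals both vanish. Combining them multiplies the integral
   by a phase and centres the oscillation at t = x. *)
have : Rintegral mu `]0, +oo[ (fun t => h x t * cos (y * ln (t / x))) = 0.
  transitivity (Rintegral mu `]0, +oo[ (fun t =>
      cos (y * ln x) * (h x t * cos (y * ln t)) +
      sin (y * ln x) * (h x t * sin (y * ln t)))).
    apply: eq_Rintegral => t /set_mem /=; rewrite in_itv/= andbT => t0.
    by rewrite ln_div ?posrE// mulrBr cosB; ring.
  rewrite RintegralD//; try exact: integrable_EFinZ.
  by rewrite !RintegralZl// c0 s0 !mulr0 addr0.
have x1i : mu.-integrable `]0, +oo[ (EFin \o h (x + 1)) by apply: hi; rewrite addr_gt0.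
have xm1i : mu.-integrable `]0, +oo[ (EFin \o h (x - 1)) by exact: hi.
(* The two bounds above give cos (y ln (t/x)) >= 1 - 2 y^2 (t/x - 2 + x/t). Multiplied by [h x t],
   the terms in t and 1/t become [h (x + 1)] and [h (x - 1)], with these coefficients. *)
pose a := 1 + 4 * y ^+ 2; pose b := - (2 * y ^+ 2 / x); pose c := - (2 * y ^+ 2 * x).
have le : Rintegral mu `]0, +oo[ (fun t =>
      a * h x t + b * h (x + 1) t + c * h (x - 1) t) <=
    Rintegral mu `]0, +oo[ (fun t => h x t * cos (y * ln (t / x))).
  apply: le_Rintegral => //.
  - apply: integrable_EFinD => //; last exact: integrable_EFinZ.
    by apply: integrable_EFinD => //; apply: integrable_EFinZ => //; exact: hi.
  - apply: ib; last by move=> t; exact: cos_max.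
    apply: (measurableT_comp (continuous_measurable_fun (@continuous_cos R))).
    apply: measurable_funM; first exact: measurable_cst.
    apply: (measurableT_comp (@measurable_ln R)).
    by apply: measurable_funM => //; exact: measurable_cst.
  - move=> t; rewrite /= in_itv/= andbT => t0.
    have -> : h (x + 1) t = h x t * t.
      by rewrite /h addrK -[x in LHS](subrK 1) mulrDl mul1r expRD lnK//; ring.
    have -> : h (x - 1) t = h x t / t by rewrite /h expR_mul_lnB1//; ring.
    have tx : 0 < t / x by rewrite divr_gt0.
    rewrite [leLHS](_ : _ = h x t * (1 - 2 * y ^+ 2 * (t / x - 2 + (t / x)^-1))).
      apply: ler_wpM2l => //; apply: (le_trans _ (cos_ge_quadratic _)).
      have := sqr_ln_le tx; rewrite exprMn.
      by move: (ln _ ^+ 2) (t / x - 2 + _) => l r hl; nra.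
    by rewrite /a /b /c; field; rewrite !gt_eqF.
move=> E; move: le; rewrite E; apply/negP; rewrite -ltNge.
rewrite RintegralD//; last 2 first.
- by apply: integrable_EFinD => //; apply: integrable_EFinZ => //; exact: hi.
- exact: integrable_EFinZ.
rewrite RintegralD//; last 2 first.
- by apply: integrable_EFinZ => //; exact: hi.
- exact: integrable_EFinZ.
rewrite !RintegralZl//; last exact: hi.
rewrite -/(G _) -/(G _) -/(G _) GS//.
have -> : G x = (x - 1) * G (x - 1) by rewrite -GS// subrK.
have g0 : 0 < G (x - 1) by apply: G_gt0; lra.
(* The functional equation expresses all three moments through G(x - 1). The sum is positive because
   x > 2 + 2 y^2, contradicting the vanishing integral. *)
rewrite [ltRHS](_ : _ = G (x - 1) * (x - 1 - 2 * y ^+ 2)).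
  by rewrite mulr_gt0//; lra.
by rewrite /a /b /c; field; rewrite gt_eqF.
Qed.

Lemma Gamma_neq0 z : 0 < complex.Re z -> Gamma z != 0.
Proof.
move=> z0; apply/eqP => Gz.
have G0 n : Gamma (z + n%:R) = 0.
  elim: n => [|n IH]; first by rewrite addr0.
  by rewrite -natr1 addrA GammaS ?IH ?mulr0// cReD cRe_nat ltr_wpDr.
(* Adding n leaves Im z unchanged and takes Re z past the threshold of [Gamma_neq0_large]. *)
pose n := (Num.truncn (2 + 2 * complex.Im z ^+ 2)).+1.
have /eqP := G0 n; apply/negP; apply: Gamma_neq0_large.
rewrite cReD cImD cRe_nat cIm_nat addr0.
by rewrite (lt_trans (truncnS_gt _))// ltrDr.
Qed.

Lemma betaJ_Gamma (X : R) s v : 0 < X -> 0 < complex.Re s -> 0 <= complex.Re v ->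
  betaJ X s v = cpowR X s * (Gamma s * Gamma (v + 1) / Gamma (s + v + 1)).
Proof.
move=> X0 s0 v0; rewrite betaJ_scale//; congr (_ * _).
have : Gamma (s + v + 1) != 0.
  by apply: Gamma_neq0; rewrite -addrA cReD cReD addr_gt0// ltr_wpDl.
by move=> /mulIf; apply; rewrite divfK ?betaJ_Gamma1 1?mulrC// Gamma_neq0//
  -addrA cReD cReD addr_gt0// ltr_wpDl.
Qed.

End gamma_neq0.

(** * The k-Struve series *)

Section exp_dominated_series.
Context {R : realType}.

Lemma sum_exp_coeff_le (a : R) n : 0 <= a ->
  \sum_(r < n) a ^+ r / r`!%:R <= expR a.
Proof.
move=> a0; rewrite /expR -(big_mkord xpredT (fun r => exp_coeff a r)).
apply: nondecreasing_cvgn_le; last exact: is_cvg_series_exp_coeff.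
by apply: nondecreasing_series => i _ _; exact: exp_coeff_ge0.
Qed.

Variables (u : nat -> R[i]) (B a : R).
Hypotheses (a0 : 0 <= a) (uB : forall r, normc (u r) <= B * (a ^+ r / r`!%:R)).

Let B0 : 0 <= B.
Proof. by have := uB 0; rewrite expr0 fact0 divr1 mulr1; apply: le_trans; exact: normc_ge0. Qed.

Lemma normc_sum_exp_le n : normc (\sum_(r < n) u r) <= B * expR a.
Proof.
apply: (le_trans (normc_sum _ _)).
apply: (@le_trans _ _ (\sum_(r < n) B * (a ^+ r / r`!%:R))); first exact: ler_sum.
by rewrite -mulr_sumr ler_wpM2l// sum_exp_coeff_le.
Qed.

Lemma ccvg_csum_exp : ccvg (fun n => \sum_(r < n) u r) (csum u).
Proof.
have cv (v : nat -> R) : (forall r, `|v r| <= B * (a ^+ r / r`!%:R)) ->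
    cvgn (series v).
  move=> vB; apply: normed_cvg; apply: (@series_le_cvg _ _ (fun r => B * exp_coeff a r)).
  - by move=> r; exact: normr_ge0.
  - by move=> r; rewrite mulr_ge0// exp_coeff_ge0.
  - exact: vB.
  - rewrite (_ : series _ = (fun n => B * series (exp_coeff a) n)).
      by apply: is_cvgMr; exact: is_cvg_series_exp_coeff.
    by apply/funext => n; rewrite /series/= mulr_sumr.
have cr : cvgn (series (fun r => complex.Re (u r))).
  by apply: cv => r; rewrite (le_trans (Re_le_normc _)).
have ci : cvgn (series (fun r => complex.Im (u r))).
  by apply: cv => r; rewrite (le_trans (Im_le_normc _)).
have h : ccvg (fun n => \sum_(r < n) u r)
    (lim (series (fun r => complex.Re (u r)) @ \oo) +i*
     lim (series (fun r => complex.Im (u r)) @ \oo)).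
  split => /=.
    by under eq_fun do rewrite cRe_sum -(big_mkord xpredT (fun r => complex.Re (u r))).
  by under eq_fun do rewrite cIm_sum -(big_mkord xpredT (fun r => complex.Im (u r))).
by rewrite (ccvg_csum h).
Qed.

(** The terms after the first add up to at most B (e^a - 1), while the first has modulus exactly
    B. *)
Lemma normc_csum_exp_ge : normc (u 0) = B -> B * (2 - expR a) <= normc (csum u).
Proof.
move=> u0; have := ccvg_normc ccvg_csum_exp; rewrite -(cvg_shiftS _ _) => h.
rewrite -(cvg_lim (@Rhausdorff R) h); apply: limr_ge; first by apply/cvg_ex; eexists; exact: h.
apply: nearW => n; rewrite /= big_ord_recl/=.
set s := \sum_(_ < _) _.
have hs : normc s <= B * (expR a - 1).
  apply: (le_trans (normc_sum (fun r => u r.+1) n)).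
  apply: (@le_trans _ _ (\sum_(r < n) B * (a ^+ r.+1 / r.+1`!%:R))); first by apply: ler_sum.
  rewrite -mulr_sumr ler_wpM2l// lerBrDl.
  have := sum_exp_coeff_le n.+1 a0; rewrite big_ord_recl/=.
  by rewrite expr0 fact0 divr1.
have : normc (u 0) <= normc (u 0 + s) + normc s.
  rewrite -{1}(addrK s (u 0)); apply: (le_trans (le_normcD _ _)).
  by rewrite normcN.
rewrite u0; lra.
Qed.

End exp_dominated_series.

(** * Divergence of the integral of 1/t at the origin *)

Section not_integrable.
Context {R : realType}.
Notation mu := (@lebesgue_measure R).

(** On the n-th compact interval the integral is ln (n + 2), the quotient of the endpoints being n +
    2, and this is unbounded. *)
Lemma not_integrable_inv (d : R) : 0 < d ->
  ~ mu.-integrable `]0, d[ (EFin \o (fun t : R => t^-1)).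
Proof.
move=> d0 id; have Ed := exhausts_itvoo d0.
have [_ _ ab _] := Ed.
pose a n := d / n.+3%:R; pose b n := d - d / n.+3%:R.
have a0 n : 0 < a n by rewrite divr_gt0.
have le n : ln (b n) - ln (a n) <= Rintegral mu `]0, d[ (fun t : R => t^-1).
  rewrite -lee_fin /Rintegral fineK; last exact: integrable_fin_num id.
  have E := @FTC_itvcc R (fun t => t^-1) (@ln R) _ _ (ab n).
  rewrite -[leLHS]E.
  - apply: ge0_subset_integral => //.
    + exact: measurable_int id.
    + by move=> t /=; rewrite in_itv/= => /andP[t0 _]; rewrite lee_fin invr_ge0 ltW.
    + exact: (exhausts_sub Ed).
  - move=> t /andP[at_ _]; apply: is_derive1_ln.
    by apply: lt_le_trans at_; exact: a0.
  - move=> t /andP[at_ _]; apply: inv_continuous.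
    by rewrite gt_eqF//; apply: lt_le_trans at_; exact: a0.
set I := Rintegral _ _ _ in le.
pose n := Num.truncn (expR I).
have := le n; apply/negP; rewrite -ltNge -ln_div ?posrE//; last first.
  by apply: lt_trans (ab n); exact: a0.
rewrite (_ : b n / a n = n.+2%:R).
  rewrite -[ltLHS]expRK ltr_ln ?posrE ?expR_gt0 ?ltr0n//.
  by rewrite (lt_trans (truncnS_gt _))// ltr_nat.
rewrite /b /a -[n.+3%:R]natr1; move: (n.+2%:R : R) (ltr0Sn R n.+1) => m m0.
by field; rewrite !gt_eqF// addr_gt0.
Qed.

End not_integrable.

(** * Bounds and termwise integration for the k-Struve series *)

Section struve.
Context {R : realType}.
Notation mu := (@lebesgue_measure R).
Variables (k lam : R) (c : R[i]).
Hypotheses (k0 : 0 < k) (lam_gt : - (3 / 2) < lam).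

(** The Struve denominator with [kGamma] unfolded at nu = k lam: the argument divided by k is r +
    lam + 3/2, so the power of k has exponent r + lam + 1/2. *)
Definition struve_den r : R[i] :=
  cpowR k (r%:R + lam%:C + 1 / 2) * Gamma (r%:R + lam%:C + 3 / 2) *
  Gamma (r%:R + 3 / 2).

Definition struve_term (t : R) r : R[i] :=
  (- c) ^+ r / struve_den r * cpowR (t / 2) ((2 * r)%:R + lam%:C + 1).

Lemma kStruveE (t : R) : kStruve k (k * lam)%:C c t = csum (struve_term t).
Proof.
congr csum; apply/funext => r; rewrite /struve_term /struve_den /kGamma.
have kn0 : k%:C != 0 :> R[i] by rewrite (fmorph_eq0 (real_complex R)) gt_eqF.
have -> : (r%:R * k%:C + (k * lam)%:C + 3 * k%:C / 2) / k%:C =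
    r%:R + lam%:C + 3 / 2 by rewrite rmorphM/=; field.
have -> : (k * lam)%:C / k%:C = lam%:C by rewrite rmorphM/= mulrC mulKf.
by have -> : r%:R + lam%:C + 3 / 2 - 1 = r%:R + lam%:C + 1 / 2 :> R[i] by field.
Qed.

Lemma three_halfE : 3 / 2 = (3 / 2 : R)%:C :> R[i].
Proof. by rewrite rmorphM/= fmorphV !rmorph_nat. Qed.

Let arg1E r : r%:R + lam%:C + 3 / 2 = (r%:R + lam + 3 / 2)%:C :> R[i].
Proof. by rewrite three_halfE !rmorphD/= rmorph_nat. Qed.

Let arg2E r : r%:R + 3 / 2 = (r%:R + 3 / 2)%:C :> R[i].
Proof. by rewrite three_halfE !rmorphD/= rmorph_nat. Qed.

Let arg1_gt0 r : 0 < r%:R + lam + 3 / 2.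
Proof. have := ler0n R r; move: lam_gt; lra. Qed.

Let arg2_gt0 r : 0 < r%:R + 3 / 2 :> R.
Proof. have := ler0n R r; lra. Qed.

Lemma struve_den_neq0 r : struve_den r != 0.
Proof.
rewrite /struve_den; apply: mulf_neq0; last first.
  by apply: Gamma_neq0; rewrite arg2E; exact: arg2_gt0.
by apply: mulf_neq0; [exact: cpowR_neq0|apply: Gamma_neq0; rewrite arg1E; exact: arg1_gt0].
Qed.

Lemma struve_denS r : struve_den r.+1 =
  struve_den r * (k * (r%:R + lam + 3 / 2) * (r%:R + 3 / 2))%:C.
Proof.
rewrite /struve_den -natr1.
have -> : r%:R + 1 + lam%:C + 1 / 2 = (r%:R + lam%:C + 1 / 2) + 1 :> R[i] by ring.
have -> : r%:R + 1 + lam%:C + 3 / 2 = (r%:R + lam%:C + 3 / 2) + 1 :> R[i] by ring.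
have -> : r%:R + 1 + 3 / 2 = (r%:R + 3 / 2) + 1 :> R[i] by ring.
rewrite (GammaS (z := r%:R + 3 / 2)); last by rewrite arg2E; exact: arg2_gt0.
rewrite (GammaS (z := _ + 3 / 2)); last by rewrite arg1E; exact: arg1_gt0.
rewrite arg1E arg2E cpowRD cpowR1// !rmorphM/=; ring.
Qed.

(** [B0] and [M0] are the constants of the domination: the r-th term has modulus at most B0
    (t/2)^(lam+1) (M0 (t/2)^2)^r / r!. *)
Let B0 : R := (normc (struve_den 0))^-1.
Let M0 : R := normc c / (k * (lam + 3 / 2)).

Let B0_gt0 : 0 < B0.
Proof.
by rewrite invr_gt0 lt_def normc_ge0 andbT normc_eq0 struve_den_neq0.
Qed.

Let d0 : 0 < lam + 3 / 2. Proof. by move: lam_gt; lra. Qed.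

Let M0_ge0 : 0 <= M0.
Proof. by rewrite divr_ge0 ?normc_ge0// mulr_ge0// ltW. Qed.

(** The quotient of successive denominators is k (r + lam + 3/2) (r + 3/2), at least k (lam + 3/2)
    (r + 1). The factor r + 1 builds up the factorial. *)
Lemma normc_struve_den_ge r :
  normc (struve_den 0) * (k * (lam + 3 / 2)) ^+ r * r`!%:R <= normc (struve_den r).
Proof.
elim: r => [|r IH]; first by rewrite expr0 fact0 !mulr1.
have r0 := ler0n R r.
rewrite struve_denS [leRHS](normcM (struve_den r)) normc_real ger0_norm; last first.
  by rewrite ltW// !mulr_gt0.
rewrite factS natrM exprS.
have -> : normc (struve_den 0) * (k * (lam + 3 / 2) * (k * (lam + 3 / 2)) ^+ r) *
    (r.+1%:R * r`!%:R) = normc (struve_den 0) * (k * (lam + 3 / 2)) ^+ r * r`!%:R *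
    (k * (lam + 3 / 2) * r.+1%:R) by ring.
apply: ler_pM => //.
- by rewrite !mulr_ge0 ?normc_ge0 ?exprn_ge0// mulr_ge0// ltW.
- by rewrite !mulr_ge0// ltW.
- apply: ler_pM => //; [by rewrite mulr_ge0// ltW| |].
    by rewrite ler_pM2l//; lra.
  by rewrite -natr1; lra.
Qed.

Let E (t : R) := expR ((lam + 1) * ln (t / 2)).

Lemma normc_struve_term_le (t : R) r : 0 < t ->
  normc (struve_term t r) <= B0 * E t * ((M0 * (t / 2) ^+ 2) ^+ r / r`!%:R).
Proof.
move=> t0; have t20 : 0 < t / 2 by rewrite divr_gt0.
rewrite /struve_term (normcM (_ / _)) (normcM (_ ^+ _)) normcV normcX normcN.
rewrite -addrA cpowRD (normcM (cpowR _ _)) cpowR_nat// normcX normc_real.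
rewrite gtr0_norm// normc_cpowR/= -/(E t).
have f0 : 0 < r`!%:R :> R by rewrite ltr0n fact_gt0.
have n0 : 0 < normc (struve_den 0) by rewrite -invr_gt0.
have kd : 0 < k * (lam + 3 / 2) by rewrite mulr_gt0.
have h : (normc (struve_den r))^-1 <=
    B0 * ((k * (lam + 3 / 2)) ^+ r)^-1 * (r`!%:R)^-1.
  rewrite /B0 -!invfM lef_pV2 ?posrE ?normc_struve_den_ge//.
    by rewrite lt_def normc_ge0 andbT normc_eq0 struve_den_neq0.
  by rewrite !mulr_gt0// exprn_gt0.
rewrite [leRHS](_ : _ = normc c ^+ r *
    (B0 * ((k * (lam + 3 / 2)) ^+ r)^-1 * (r`!%:R)^-1) * ((t / 2) ^+ (2 * r) * E t)).
  apply: ler_wpM2r; first by rewrite mulr_ge0 ?expR_ge0// exprn_ge0// ltW.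
  by apply: ler_wpM2l; first by rewrite exprn_ge0// normc_ge0.
rewrite /M0; move: (t / 2) (k * _) => y q.
by rewrite exprM !exprMn exprVn; ring.
Qed.

Lemma normc_struve_term0 (t : R) : normc (struve_term t 0) = B0 * E t.
Proof.
rewrite /struve_term expr0 div1r normcM normcV normc_cpowR !cReD muln0 add0r/=.
by [].
Qed.

Lemma ccvg_kStruve (t : R) : 0 < t ->
  ccvg (fun n => \sum_(r < n) struve_term t r) (kStruve k (k * lam)%:C c t).
Proof.
move=> t0; rewrite kStruveE.
by apply: (ccvg_csum_exp (a := M0 * (t / 2) ^+ 2) (B := B0 * E t));
  [rewrite mulr_ge0 ?sqr_ge0|move=> r; exact: normc_struve_term_le].
Qed.

(** The constant does not depend on [n], as dominated convergence requires; e^(M0 (t/2)^2) is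
    replaced by its larger value at X. *)
Lemma normc_sum_struve_le (X : R) : exists C : R, forall n t, 0 < t < X ->
  normc (\sum_(r < n) struve_term t r) <= C * expR ((lam + 1) * ln t).
Proof.
exists (B0 * expR (- (lam + 1) * ln 2) * expR (M0 * (X / 2) ^+ 2)) => n t /andP[t0 tX].
have h := normc_sum_exp_le (u := struve_term t) (B := B0 * E t)
  (a := M0 * (t / 2) ^+ 2) _ (fun r => normc_struve_term_le r t0) n.
apply: le_trans (h _) _; first by rewrite mulr_ge0 ?sqr_ge0.
rewrite /E ln_div ?posrE// (mulrBr (lam + 1)) expRB mulNr expRN.
rewrite [leRHS](_ : _ = B0 * (expR ((lam + 1) * ln t) / expR ((lam + 1) * ln 2)) *
  expR (M0 * (X / 2) ^+ 2)); last by ring.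
have K0 : 0 <= B0 * (expR ((lam + 1) * ln t) / expR ((lam + 1) * ln 2)).
  by rewrite mulr_ge0 ?divr_ge0 ?expR_ge0// ltW.
rewrite ler_wpM2l// ler_expR.
by apply: ler_wpM2l => //; apply: lerXn2r; rewrite ?nnegrE; lra.
Qed.

Lemma normc_kStruve_ge : exists d C : R, [/\ 0 < d, d <= 1, 0 < C &
  forall t, 0 < t < d ->
    C * expR ((lam + 1) * ln t) <= normc (kStruve k (k * lam)%:C c t)].
Proof.
have l0 : 0 < ln (3 / 2) :> R by apply: ln_gt0; lra.
have M1 : 0 < M0 + 1 by rewrite ltr_wpDl.
(* For t < 1, M0 (t/2)^2 <= (M0 + 1) t, so below this threshold the exponential is at most 3/2 and 2
   minus it at least 1/2. Using M0 + 1 avoids dividing by 0 when c = 0. *)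
exists (Num.min 1 (ln (3 / 2) / (M0 + 1))).
exists (B0 * expR (- (lam + 1) * ln 2) / 2).
split.
- by rewrite lt_min ltr01 divr_gt0.
- by rewrite ge_min lexx.
- by rewrite divr_gt0// mulr_gt0 ?expR_gt0.
move=> t /andP[t0]; rewrite lt_min => /andP[t1 tM].
rewrite kStruveE.
have h := normc_csum_exp_ge (u := struve_term t) (B := B0 * E t)
  (a := M0 * (t / 2) ^+ 2) _ (fun r => normc_struve_term_le r t0)
  (normc_struve_term0 t).
apply: le_trans _ (h _); last by rewrite mulr_ge0 ?sqr_ge0.
have e32 : expR (M0 * (t / 2) ^+ 2) <= 3 / 2.
  rewrite -[leRHS]lnK ?posrE; last by lra.
  rewrite ler_expR; rewrite ltr_pdivlMr// in tM.
  apply: le_trans (ltW tM).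
  have : M0 * (t / 2) ^+ 2 <= M0 * t by apply: ler_wpM2l => //; nra.
  by rewrite mulrDr mulr1 [t * M0]mulrC; lra.
rewrite /E ln_div ?posrE// (mulrBr (lam + 1)) expRB mulNr expRN.
rewrite [leLHS](_ : _ = B0 * (expR ((lam + 1) * ln t) / expR ((lam + 1) * ln 2)) *
  (1 / 2)); last by ring.
have K0 : 0 <= B0 * (expR ((lam + 1) * ln t) / expR ((lam + 1) * ln 2)).
  by rewrite mulr_ge0 ?divr_ge0 ?expR_ge0// ltW.
rewrite ler_wpM2l//; lra.
Qed.

(** Otherwise Re rho + lam <= -1, and for small t < 1 the integrand has modulus at least C t^(Re rho
    + lam) >= C / t, which would make 1/t integrable near 0. *)
Lemma Re_gt0_cintegrable (X : R) (rho : R[i]) : 0 < X ->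
  cintegrable `]0, X[ (fun t => cpowR t (rho - 1) * kStruve k (k * lam)%:C c t) ->
  0 < complex.Re rho + lam + 1.
Proof.
move=> X0 fi; rewrite ltNge; apply/negP => s0.
have [d [C [d_gt0 d1 C0 dC]]] := normc_kStruve_ge.
pose e := Num.min d X.
have e0 : 0 < e by rewrite lt_min d_gt0.
have mX : measurable (`]0, X[%classic : set R) by [].
have me : measurable (`]0, e[%classic : set R) by [].
apply: (not_integrable_inv e0).
have gi := integrable_normc mX fi.
have {}gi : mu.-integrable `]0, e[ (EFin \o (fun t =>
    `|complex.Re (cpowR t (rho - 1) * kStruve k (k * lam)%:C c t)| +
    `|complex.Im (cpowR t (rho - 1) * kStruve k (k * lam)%:C c t)|)).
  apply: integrableS gi => // t /=; rewrite !in_itv/= => /andP[-> te].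
  by rewrite (lt_le_trans te)// ge_min lexx orbT.
have {}gi := integrable_EFinZ C^-1 me gi.
apply: (@le_integrable _ _ _ mu _ me _ _ _ _ gi).
  apply/measurable_EFinP; apply: open_continuous_measurable_fun.
    exact: interval_open.
  move=> t /set_mem /=; rewrite in_itv/= => /andP[t0 _].
  by apply: inv_continuous; rewrite gt_eqF.
move=> t /=; rewrite in_itv/= => /andP[t0]; rewrite lt_min => /andP[td tX].
rewrite lee_fin gtr0_norm ?invr_gt0// (le_trans _ (ler_norm _))//.
rewrite ler_pdivlMl//.
apply: le_trans (normc_le_ReIm _); rewrite normcM normc_cpowR.
have td' : 0 < t < d by rewrite t0.
apply: (@le_trans _ _ (expR (complex.Re (rho - 1) * ln t) *
    (C * expR ((lam + 1) * ln t)))); last by rewrite ler_wpM2l ?expR_ge0// dC.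
rewrite mulrCA -expRD ler_pM2l// -mulrDl cReD cReN/=.
rewrite -{1}[t]lnK// -expRN ler_expR.
have lt0 : ln t <= 0 by rewrite ln_le0// ltW// (lt_le_trans td).
nra.
Qed.

(** Each term contributes t^(2r + lam + 1), which merges with t^(rho - 1) into a beta integrand. All
    partial sums are dominated by C t^(Re rho + lam), whose exponent exceeds -1. *)
Lemma cintegral_kStruve (X : R) (rho v : R[i]) : 0 < X ->
  0 <= complex.Re v -> 0 < complex.Re rho + lam + 1 ->
  ccvg (fun n => \sum_(r < n) (- c) ^+ r / struve_den r *
      cpowR 2^-1 ((2 * r)%:R + lam%:C + 1) *
      betaJ X (rho + lam%:C + 1 + (2 * r)%:R) v)
    (cintegral `]0, X[ (fun t => cpowR (1 - t / X) v *
       (cpowR t (rho - 1) * kStruve k (k * lam)%:C c t))).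
Proof.
move=> X0 v0 s0.
have mX : measurable (`]0, X[%classic : set R) by [].
pose A r : R[i] := (- c) ^+ r / struve_den r * cpowR 2^-1 ((2 * r)%:R + lam%:C + 1).
pose s r : R[i] := rho + lam%:C + 1 + (2 * r)%:R.
have sr0 r : 0 < complex.Re (s r).
  by rewrite /s !cReD cRe_nat/= ltr_wpDr.
have termE r t : 0 < t -> cpowR (1 - t / X) v * (cpowR t (rho - 1) * struve_term t r) =
    A r * betaI X (s r) v t.
  move=> t0; rewrite /struve_term /betaI /A cpowRM ?invr_gt0//.
  have -> : s r - 1 = (rho - 1) + ((2 * r)%:R + lam%:C + 1) by rewrite /s; ring.
  by rewrite (cpowRD _ (rho - 1)); ring.
have ib r : cintegrable `]0, X[ (fun t => A r * betaI X (s r) v t).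
  by apply: cintegrableZ => //; exact: cintegrable_betaI.
have [C hC] := normc_sum_struve_le X.
pose u n t := \sum_(r < n) A r * betaI X (s r) v t.
have uE n t : 0 < t -> u n t =
    cpowR (1 - t / X) v * (cpowR t (rho - 1) * \sum_(r < n) struve_term t r).
  by move=> t0; rewrite !mulr_sumr; apply: eq_bigr => r _; rewrite termE.
have -> : (fun n => \sum_(r < n) (- c) ^+ r / struve_den r *
      cpowR 2^-1 ((2 * r)%:R + lam%:C + 1) *
      betaJ X (rho + lam%:C + 1 + (2 * r)%:R) v) =
    (fun n => cintegral `]0, X[ (u n)).
  apply/funext => n.
  have [_ ->] := cintegral_sum n mX ib.
  by apply: eq_bigr => r _; rewrite cintegralZ//; exact: cintegrable_betaI.
apply: (proj2 (A := cintegrable `]0, X[ (fun t => cpowR (1 - t / X) v *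
       (cpowR t (rho - 1) * kStruve k (k * lam)%:C c t)))).
apply: (dominated_cvg_cintegral mX _ _
  (integrable_EFinZ C mX (integrable_powR_itv0 s0 X0))).
- move=> n; apply: (@cmeasurable_sum _ _ (fun r t => A r * betaI X (s r) v t)) => r.
  exact: cintegrable_cmeasurable.
- move=> t /=; rewrite in_itv/= => /andP[t0 _].
  rewrite (_ : (fun n => _) = (fun n => cpowR (1 - t / X) v *
      (cpowR t (rho - 1) * \sum_(r < n) struve_term t r))).
    by apply: ccvgZ; apply: ccvgZ; exact: ccvg_kStruve.
  by apply/funext => n; rewrite uE.
- move=> n t /=; rewrite in_itv/= => tX; have /andP[t0 _] := tX.
  have /andP[y0 y1] := itvoo_oneB X0 tX.
  rewrite uE// (normcM (cpowR (1 - _) _)) (normcM (cpowR t _)) !normc_cpowR.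
  have h1 : expR (complex.Re v * ln (1 - t / X)) <= 1.
    by rewrite expR_le1 mulr_ge0_le0// ln_le0// ltW.
  rewrite -[leRHS]mul1r ler_pM ?expR_ge0 ?mulr_ge0 ?expR_ge0 ?normc_ge0//.
  rewrite (_ : (complex.Re rho + lam + 1 - 1) * ln t =
    complex.Re (rho - 1) * ln t + (lam + 1) * ln t); last first.
    by rewrite cReD cReN/=; ring.
  by rewrite expRD mulrCA ler_wpM2l ?expR_ge0// hC.
Qed.

End struve.

(** The numerator pair (1, 1) is Gamma(1 + r) = r!, which cancels the factorial built into the
    Wright series, since the Struve series has none. The powers k^r of the k-gamma function, 4^(-r)
    and X^(2r) go into the argument. *)
Lemma struve_wright_term (R : realType) (k lam X : R) (c rho v : R[i]) (r : nat) :
  0 < k -> - (3 / 2) < lam -> 0 < X -> 0 <= complex.Re v ->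
  0 < complex.Re rho + lam + 1 ->
  (- c) ^+ r / struve_den k lam r * cpowR 2^-1 ((2 * r)%:R + lam%:C + 1) *
    betaJ X (rho + lam%:C + 1 + (2 * r)%:R) v =
  cpowR X (rho + lam%:C + 1) *
  (Gamma (1 + v) / (cpowR k (lam%:C + 1 / 2) * cpowR 2 (lam%:C + 1))) *
  (\prod_(p <- [:: (rho + lam%:C + 1, 2); (1, 1)])
      Gamma (p.1 + p.2%:C * r%:R) /
   \prod_(q <- [:: (rho + lam%:C + v + 2, 2); (lam%:C + 3 / 2, 1); (3 / 2, 1)])
      Gamma (q.1 + q.2%:C * r%:R) *
   ((- (c * (X ^+ 2 / (4 * k))%:C)) ^+ r / r`!%:R)).
Proof.
move=> k0 lam_gt X0 v0 s0.
rewrite !big_cons !big_nil !mulr1 /= !rmorph1 !(mul1r r%:R) (rmorph_nat (real_complex R)).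
have -> : 1 + r%:R = r.+1%:R :> R[i] by rewrite -(natrD _ 1).
rewrite Gamma_nat betaJ_Gamma//; last first.
  by rewrite !cReD cRe_nat/= ltr_wpDr.
rewrite /struve_den.
have f0 : r`!%:R != 0 :> R[i] by rewrite pnatr_eq0 -lt0n fact_gt0.
have two : (2 * r)%:R = 2 * r%:R :> R[i] by rewrite natrM.
have -> : rho + lam%:C + 1 + (2 * r)%:R + v + 1 = rho + lam%:C + v + 2 + 2 * r%:R.
  by rewrite two; ring.
have -> : r%:R + lam%:C + 3 / 2 = lam%:C + 3 / 2 + r%:R :> R[i] by ring.
have -> : r%:R + 3 / 2 = 3 / 2 + r%:R :> R[i] by ring.
have -> : cpowR k (r%:R + lam%:C + 1 / 2) =
    (k%:C) ^+ r * cpowR k (lam%:C + 1 / 2).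
  by rewrite -addrA (cpowRD _ r%:R) cpowR_nat.
have -> : cpowR X (rho + lam%:C + 1 + (2 * r)%:R) =
    cpowR X (rho + lam%:C + 1) * (X%:C) ^+ (2 * r).
  by rewrite (cpowRD _ (rho + lam%:C + 1)) cpowR_nat.
have -> : cpowR 2^-1 ((2 * r)%:R + lam%:C + 1) =
    (2^-1 ^+ 2) ^+ r / cpowR 2 (lam%:C + 1) :> R[i].
  by rewrite -addrA (cpowRD _ (2 * r)%:R) cpowR_nat// cpowRV// exprM fmorphV rmorph_nat.
have -> : (- (c * (X ^+ 2 / (4 * k))%:C)) ^+ r =
    (- c) ^+ r * (2^-1 ^+ 2) ^+ r * (X%:C) ^+ (2 * r) / (k%:C) ^+ r.
  rewrite exprM -exprVn -!exprMn; congr (_ ^+ r).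
  rewrite rmorphM/= fmorphV rmorphXn/= rmorphM/= rmorph_nat -[4]/((2 * 2)%:R) natrM.
  by field; rewrite fmorph_eq0 gt_eqF.
rewrite two (addrC v 1).
have := f0; have := cpowR_neq0 k (lam%:C + 1 / 2).
have := cpowR_neq0 2 (lam%:C + 1 : R[i]).
have : k%:C ^+ r != 0 :> R[i] by rewrite expf_neq0// fmorph_eq0 gt_eqF.
move: (k%:C ^+ r) (cpowR k _) (cpowR 2 _) (r`!%:R) => kr ck c2 f kr0 c20 ck0 fn0.
move: (Gamma (rho + lam%:C + v + 2 + 2 * r%:R)) (Gamma (lam%:C + 3 / 2 + r%:R))
  (Gamma (3 / 2 + r%:R)) => g1 g2 g3.
(* The inverses of the gamma factors are generalized, so [field] asks for no nonvanishing of these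
   factors. *)
rewrite !invfM; move: g1^-1 g2^-1 g3^-1 => h1 h2 h3.
by field; rewrite kr0 c20 ck0 fn0.
Qed.

Unset Implicit Arguments.

(* In the order of R[i], the hypothesis hnu says that nu is real and that
   nu > - 3k/2. *)
Theorem theorem2p1 (R : realType) (k a x : R) (eta rho nu c : R[i]) (alpha : R)
  (hk : 0 < k) (ha : 0 < a) (hx : 0 < x) (halpha : alpha < 1)
  (heta : 0 < complex.Re eta) (hrho : 0 < complex.Re rho)
  (hnu : (- (3 / 2 * k))%:C < nu)
  (hetaalpha : -1 < complex.Re (eta / (1 - alpha)%:C))
  (hint : cintegrable `]0, x / (a * (1 - alpha))[
            (fun t : R => cpowR t (rho - 1) * kStruve k nu c t)) :
  pathway a eta alpha (fun t : R => cpowR t (rho - 1) * kStruve k nu c t) x =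
  cpowR x eta *
  cpowR (x / (a * (1 - alpha))) (rho + nu / k%:C + 1) *
  (Gamma (1 + eta / (1 - alpha)%:C) /
   (cpowR k (nu / k%:C + 1 / 2) * cpowR 2 (nu / k%:C + 1))) *
  wrightPsi
    [:: (rho + nu / k%:C + 1, 2); (1, 1)]
    [:: (rho + nu / k%:C + eta / (1 - alpha)%:C + 2, 2);
        (nu / k%:C + 3 / 2, 1);
        (3 / 2, 1)]
    (- (c * (x ^+ 2)%:C / (4 * k * a ^+ 2 * (1 - alpha) ^+ 2)%:C)).
Proof.
have b0 : 0 < 1 - alpha by rewrite subr_gt0.
set X := x / (a * (1 - alpha)) in hint *.
have X0 : 0 < X by rewrite divr_gt0// mulr_gt0.
set v := eta / (1 - alpha)%:C in hetaalpha *.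
(* As 1 - alpha is a positive real, Re v is Re eta / (1 - alpha). *)
have v0 : 0 <= complex.Re v.
  by rewrite /v -fmorphV cReM/= mulr0 subr0 ltW// mulr_gt0// invr_gt0.
have kn0 : k%:C != 0 :> R[i] by rewrite fmorph_eq0 gt_eqF.
pose lam := complex.Re nu / k.
have [nuE lam_gt] : nu = (k * lam)%:C /\ - (3 / 2) < lam.
  move: hnu; rewrite ltcE/= => /andP[/eqP nu0 nuk]; split.
    apply: complex_eq => //=; by rewrite /lam mulrC divfK// gt_eqF.
  by rewrite /lam ltr_pdivlMr// mulNr.
have nukE : nu / k%:C = lam%:C by rewrite nuE rmorphM/= mulrC mulKf.
rewrite nukE; rewrite nuE in hint *.
have s0 := Re_gt0_cintegrable hk lam_gt X0 hint.
pose K := cpowR X (rho + lam%:C + 1) *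
  (Gamma (1 + v) / (cpowR k (lam%:C + 1 / 2) * cpowR 2 (lam%:C + 1))).
(* [K] must be invertible to pass from the limit of the partial sums of [K * W r] to that of the
   partial sums of [W r]. *)
have K0 : K != 0.
  apply: mulf_neq0; first exact: cpowR_neq0.
  apply: mulf_neq0; first by apply: Gamma_neq0; rewrite cReD ltr_wpDr.
  by rewrite invr_eq0 mulf_neq0// cpowR_neq0.
have zE : - (c * (x ^+ 2)%:C / (4 * k * a ^+ 2 * (1 - alpha) ^+ 2)%:C) =
    - (c * (X ^+ 2 / (4 * k))%:C).
  congr (- _); rewrite -mulrA -fmorphV -rmorphM/=; congr (_ * _%:C).
  by rewrite /X; field; rewrite !gt_eqF.
pose W r : R[i] :=
  \prod_(p <- [:: (rho + lam%:C + 1, 2); (1, 1)]) Gamma (p.1 + p.2%:C * r%:R) /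
  \prod_(q <- [:: (rho + lam%:C + v + 2, 2); (lam%:C + 3 / 2, 1); (3 / 2, 1)])
    Gamma (q.1 + q.2%:C * r%:R) *
  ((- (c * (X ^+ 2 / (4 * k))%:C)) ^+ r / r`!%:R).
(* The convergence of the Wright series is obtained together with its value: its partial sums are
   those of the termwise integrals divided by [K]. *)
have /ccvg_csum h : ccvg (fun n => \sum_(r < n) W r)
    (K^-1 * cintegral `]0, X[ (fun t => cpowR (1 - t / X) v *
       (cpowR t (rho - 1) * kStruve k (k * lam)%:C c t))).
  have := ccvgZ K^-1 (cintegral_kStruve c hk lam_gt X0 v0 s0).
  rewrite (_ : (fun n => _) = (fun n => \sum_(r < n) W r)); first exact.
  apply/funext => n; rewrite mulr_sumr; apply: eq_bigr => r _.
  by rewrite struve_wright_term// -/K -/(W r) mulKf.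
rewrite /pathway -/X zE -2!mulrA; congr (_ * _).
rewrite mulrA -/K /wrightPsi -/W h mulVKf//.
congr (cintegral _ _); apply/funext => t; rewrite (_ : _ / x = t / X)//.
by rewrite /X; field; rewrite !gt_eqF.
Qed.
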